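(* Let $(X,d)$ be a metric space, $\phi:X\to(-\infty,+\infty]$ a proper lower semicontinuous functional, and let $v\in\mathrm{AC}^2_{\rm loc}([0,+\infty);X)$ satisfy the Energy-Dissipation Inequality $$v_0\in\mathrm{Dom}(\phi),\qquad\int_0^t\Big(\frac12|\dot v_r|^2+\frac12|\partial\phi|^2(v_r)\Big)\,\mathrm dr+\phi(v_t)\le\phi(v_0)\quad\text{for every }t>0.$$ Assume in addition that the $\mathrm{EVI}_\lambda$-gradient flow $\mathsf S_t$ of $\phi$ exists (for some $\lambda\in\mathbb R$) in a set $D\subset\overline{\mathrm{Dom}(\phi)}$ that contains the image of $v$. Then $v_t=\mathsf S_t(v_0)$ for every $t\ge0$.
   Context: $\mathrm{Dom}(\phi):=\{x\in X:\phi(x)<+\infty\}$. $v\in\mathrm{AC}^2_{\rm loc}([0,+\infty);X)$ means there is $m\in L^2_{\rm loc}([0,+\infty))$ with $d(v_s,v_t)\le\int_s^tm(r)\,\mathrm dr$ for $0\le s\le t$; then the metric derivative $|\dot v_t|:=\lim_{h\to0}d(v_{t+h},v_t)/|h|$ exists for a.e. $t$. Metric slope: $|\partial\phi|(x):=+\infty$ if $x\notin\mathrm{Dom}(\phi)$; $:=0$ if $x\in\mathrm{Dom}(\phi)$ is isolated; $:=\limsup_{y\to x}\frac{(\phi(x)-\phi(y))^+}{d(x,y)}$ otherwise. With $\frac{\mathrm d}{\mathrm dt}^{+}\zeta(t):=\limsup_{h\downarrow0}\frac{\zeta(t+h)-\zeta(t)}h$, a solution of $\mathrm{EVI}_\lambda(X,d,\phi)$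 is a continuous curve $u:(0,+\infty)\to\mathrm{Dom}(\phi)$ with $\frac12\frac{\mathrm d}{\mathrm dt}^{+}d^2(u_t,w)+\frac\lambda2d^2(u_t,w)\le\phi(w)-\phi(u_t)$ for every $t>0$, $w\in\mathrm{Dom}(\phi)$. An $\mathrm{EVI}_\lambda$-gradient flow of $\phi$ in $D$ is a family of continuous maps $\mathsf S_t:D\to D$, $t\ge0$, such that for every $u_0\in D$: $\mathsf S_{t+h}(u_0)=\mathsf S_h(\mathsf S_t(u_0))$ for all $t,h\ge0$, $\lim_{t\downarrow0}\mathsf S_t(u_0)=\mathsf S_0(u_0)=u_0$, and $t\mapsto\mathsf S_t(u_0)$ is a solution of $\mathrm{EVI}_\lambda(X,d,\phi)$. *)

(* Defs.v *)
From mathcomp Require Import all_boot all_order all_algebra.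
From mathcomp Require Import all_classical all_reals all_analysis.

Set Implicit Arguments.
Unset Strict Implicit.
Unset Printing Implicit Defensive.
Import Order.TTheory GRing.Theory Num.Theory.
Import numFieldNormedType.Exports.
Local Open Scope classical_set_scope.
Local Open Scope ring_scope.

(* Curves on [0, +oo[ or ]0, +oo[ are represented by total functions on R of
   which only the values at nonnegative (resp. positive) times matter. *)

Definition Dom {R : realType} {X : metricType R} (phi : X -> \bar R) : set X :=
  [set x | (phi x < +oo)%E].

Definition proper_functional {R : realType} {X : metricType R}
    (phi : X -> \bar R) : Prop :=
  (forall x, (-oo < phi x)%E) /\ Dom phi !=set0.

Definition L2_loc {R : realType} (m : R -> R) : Prop :=
  measurable_fun (`[0, +oo[ : set R) m /\
  forall T : R, 0 < T ->
    (\int[lebesgue_measure]_(r in `[0%R, T]) (m r ^+ 2)%:E < +oo)%E.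

Definition AC2_loc {R : realType} {X : metricType R} (v : R -> X) : Prop :=
  exists m : R -> R, L2_loc m /\
    forall s t : R, 0 <= s -> s <= t ->
      ((mdist (v s) (v t))%:E
         <= \int[lebesgue_measure]_(r in `[s, t]) (m r)%:E)%E.

Definition metric_derivative {R : realType} {X : metricType R}
    (v : R -> X) (t : R) : R :=
  lim ((mdist (v (t + h)) (v t) / `|h|) @[h --> (0 : R)^']).

(* If x is isolated the filter x^' is degenerate and the limsup would be -oo,
   hence the separate case. *)
Definition metric_slope {R : realType} {X : metricType R}
    (phi : X -> \bar R) (x : X) : \bar R :=
  if `[< ~ Dom phi x >] then +oo%E
  else if `[< isolated [set: X] x >] then 0%E
  else limf_esup
    (fun y => (maxe (phi x - phi y) 0 * ((mdist x y)^-1)%:E)%E) x^'.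

Definition dini_upper_right {R : realType} (zeta : R -> R) (t : R) : \bar R :=
  limf_esup (fun h => ((zeta (t + h) - zeta t) / h)%:E) (0 : R)^'+.

Record EVI_solution {R : realType} {X : metricType R} (lambda : R)
    (phi : X -> \bar R) (u : R -> X) : Prop := {
  EVI_continuous : {in `]0, +oo[, continuous u};
  EVI_Dom : forall t : R, 0 < t -> Dom phi (u t);
  EVI_ineq : forall (t : R) (w : X), 0 < t -> Dom phi w ->
    ((2^-1)%:E * dini_upper_right (fun s => (mdist (u s) w ^+ 2)%R) t
       + (lambda / 2 * mdist (u t) w ^+ 2)%:E <= phi w - phi (u t))%E }.

Record EVI_gradient_flow {R : realType} {X : metricType R} (lambda : R)
    (phi : X -> \bar R) (D : set X) (S : R -> X -> X) : Prop := {
  flow_maps : forall t : R, 0 <= t -> forall x, D x -> D (S t x);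
  flow_continuous : forall t : R, 0 <= t -> {within D, continuous (S t)};
  flow_semigroup : forall u0, D u0 -> forall t h : R, 0 <= t -> 0 <= h ->
    S (t + h) u0 = S h (S t u0);
  flow_id : forall u0, D u0 -> S 0 u0 = u0;
  flow_cvg0 : forall u0, D u0 -> S t u0 @[t --> (0 : R)^'+] --> u0;
  flow_EVI : forall u0, D u0 -> EVI_solution lambda phi (fun t => S t u0) }.

Definition energy_dissipation_inequality {R : realType} {X : metricType R}
    (phi : X -> \bar R) (v : R -> X) : Prop :=
  Dom phi (v 0) /\
  forall t : R, 0 < t ->
    (\int[lebesgue_measure]_(r in `[0%R, t])
        ((2^-1 * metric_derivative v r ^+ 2)%:E
           + (2^-1)%:E * metric_slope phi (v r) ^+ 2)
      + phi (v t) <= phi (v 0%R))%E.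

(* Main.v *)
Require Import Defs.
From HB Require Import structures.
From mathcomp Require Import all_boot all_order all_algebra.
From mathcomp Require Import all_classical all_reals all_analysis.
From mathcomp Require Import measurable_realfun ring lra.
Set Implicit Arguments.
Unset Strict Implicit.
Unset Printing Implicit Defensive.
Import Order.TTheory GRing.Theory Num.Theory.
Import numFieldNormedType.Exports.
Local Open Scope classical_set_scope.
Local Open Scope ring_scope.

(* For [x] in [D] with slope [K], the EVI gives, up to higher order terms in
   [h] and uniformly in [y],
     d^2(S_h x, y) <= d^2(x, y) + 2 h (phi y - phi x) + h^2 K^2.
   Take [x = v_{s + k h}], [y = v_{s + (k + 1) h}] and sum over [k].  The
   squared distances are at most [h] times the integral of [|v'|^2], the
   energies telescope, and for a well chosen offset [s] in []0, h]] the Riemann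
   sum of the squared slopes is at most its integral.  By the
   energy-dissipation inequality everything of order [h] cancels, so that
     sum_k d^2(S_h v_{s + k h}, v_{s + (k + 1) h}) = o(h),
   hence the sum of the distances tends to [0].  As [S_h] expands distances by
   at most [exp(mu h)], the orbit of [v_s] and [v] are uniformly close.  No
   differentiability of [phi] along [v] is needed. *)

(** * Upper Dini derivatives *)

(** There are [T / h] steps, so by Cauchy-Schwarz the sum of the distances is at most the square
    root of the product of [T / h] and the sum of their squares. This is why the squares must add up
    to [o(h)], and why the one-step estimate must be exact to leading order. The slope alone cannot
    give that estimate: its limsup controls [phi] only in a neighbourhood whose size depends on the
    point, while one [h] has to serve all sample points. The EVI removes this obstacle by turning
    the slope into a bound over the whole space, and the best constant in that bound is lower
    semicontinuous along the curve, so that its square can be integrated. The energy-dissipation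
    inequality starts at time [0], the sums at the offset [s]; the missing [phi (v_0) - phi (v_s)]
    vanishes in the limit because [phi] is lower semicontinuous at [v_0]. *)

Section dini.
Context {R : realType}.
Implicit Types (f g : R -> R) (a b c t : R).

(* The upper right Dini derivative of [f] at [t] is at most [c]. *)
Definition rate_le f t c :=
  forall e : R, 0 < e -> \forall h \near (0 : R)^'+, f (t + h) <= f t + (c + e) * h.

Lemma rate_le_weaken f t c c' : c <= c' -> rate_le f t c -> rate_le f t c'.
Proof.
move=> cc fc e e0; near=> h.
have h0 : 0 < h by near: h; exact: nbhs_right_gt.
have : f (t + h) <= f t + (c + e) * h by near: h; exact: fc.
move=> /le_trans; apply; rewrite lerD2l ler_wpM2r ?(ltW h0)//; lra.
Unshelve. all: by end_near. Qed.

Lemma rate_leD f g t c d : rate_le f t c -> rate_le g t d ->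
  rate_le (fun s => f s + g s) t (c + d).
Proof.
move=> fc gd e e0; near=> h.
have h0 : 0 < h by near: h; exact: nbhs_right_gt.
have fh : f (t + h) <= f t + (c + e / 2) * h.
  by near: h; apply: fc; rewrite divr_gt0.
have gh : g (t + h) <= g t + (d + e / 2) * h.
  by near: h; apply: gd; rewrite divr_gt0.
nra.
Unshelve. all: by end_near. Qed.

Lemma rate_le_derive f t c : is_derive t 1 f c -> rate_le f t c.
Proof.
move=> [/cvg_ex[l fl] fc]; have lc : l = c.
  by rewrite -fc; apply/esym/cvg_lim => //; exact: Rhausdorff.
subst l; move=> e e0; near=> h.
have h0 : 0 < h by near: h; exact: nbhs_right_gt.
have : `|c - h^-1 *: (f (h *: 1 + t) - f t)| < e.
  near: h; have /cvg_dnbhs_at_right/cvgr_dist_lt/(_ _ e0) := fl.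
  exact.
rewrite /GRing.scale/= mulr1 distrC => /ltr_normlW.
rewrite ltrBlDr mulrC ltr_pdivrMr// => /ltW.
by rewrite lerBlDr (addrC h) => /le_trans; apply; rewrite addrC (addrC c).
Unshelve. all: by end_near. Qed.

(** If [f b > 0], take the last time [t0] at which [f] is on or below a rising line of slope [e].
    There [f] meets the line, hence is positive, and the hypothesis makes it grow more slowly than
    the line: a contradiction. Asking for the rate only where [f] is positive admits rates obtained
    by dividing by a distance. *)
Lemma le0_of_rate_le0 f a b : a <= b -> continuous f -> f a <= 0 ->
  (forall t, a < t -> t < b -> 0 < f t -> rate_le f t 0) -> f b <= 0.
Proof.
move=> ab cf fa fr; rewrite leNgt; apply/negP => fb.
(* The line [e * (1 + t - a)] is positive at [a] and equals [f b / 2] at [b]; [k] is [f] minus this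
   line. *)
set e := f b / (2 * (1 + b - a)).
have ba : 0 < 1 + b - a by lra.
have e0 : 0 < e by rewrite divr_gt0// mulr_gt0.
pose k t := f t - e * (1 + t - a).
have ck : continuous k.
  move=> t; apply: cvgB; first exact: cf.
  apply: cvgMr; apply: cvgB; last exact: cvg_cst.
  by apply: cvgD; [exact: cvg_cst|exact: cvg_id].
have ka : k a < 0 by rewrite /k; nra.
have kb : 0 < k b.
  rewrite /k; have -> : e * (1 + b - a) = f b / 2.
    by rewrite /e; field; rewrite gt_eqF.
  lra.
pose A := [set t | a <= t <= b /\ k t <= 0].
have supA : has_sup A.
  split; first by exists a; split; [rewrite lexx|exact: ltW].
  by exists b => t [/andP[]].
have Ale t : A t -> t <= sup A by move=> At; apply: ub_le_sup At; exact: supA.2.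
set t0 := sup A.
have at0 : a <= t0 by apply: Ale; split; [rewrite lexx|exact: ltW].
have t0b : t0 <= b by apply: ge_sup; [exact: supA.1|move=> t [/andP[]]].
have kt0 : k t0 <= 0.
  rewrite leNgt; apply/negP => k0.
  have /cvgr_gt/(_ _ k0) := ck t0.
  move=> /nbhs_ballP[d /= d0 kd].
  have [t At t0t] := sup_adherent d0 supA.
  have := kd t; rewrite /ball/= => /(_ _)/wrap[].
    by rewrite ger0_norm ?subr_ge0 ?Ale// ltrBlDr addrC -ltrBlDr.
  by rewrite ltNge At.2.
have t0b' : t0 < b.
  by rewrite lt_neqAle t0b andbT; apply: contraTneq kb => <-; rewrite -leNgt.
have kpos t : t0 < t -> t <= b -> 0 < k t.
  move=> t0t tb; rewrite ltNge; apply/negP => kt.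
  have : A t by split => //; rewrite (le_trans at0 (ltW t0t)).
  by move=> /Ale; rewrite leNgt t0t.
have kt0' : 0 <= k t0.
  rewrite leNgt; apply/negP => k0.
  have /cvgr_lt/(_ _ k0) := ck t0.
  move=> /nbhs_ballP[d /= d0 kd].
  pose t := t0 + Num.min (d / 2) (b - t0).
  have m0 : 0 < Num.min (d / 2) (b - t0) by rewrite lt_min divr_gt0//= subr_gt0.
  have : 0 < k t.
    by apply: kpos; rewrite /t ?ltrDl// -lerBrDl ge_min lexx orbT.
  apply/negP; rewrite -leNgt; apply: ltW; apply: kd; rewrite /ball/=.
  rewrite /t opprD addNKr normrN gtr0_norm// (@le_lt_trans _ _ (d / 2))//.
    by rewrite ge_min lexx.
  lra.
have ft0 : f t0 = e * (1 + t0 - a) by move: kt0 kt0'; rewrite /k; lra.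
have at0' : a < t0.
  by rewrite lt_neqAle at0 andbT; apply: contraTneq kt0' => <-; rewrite -ltNge.
have ft0' : 0 < f t0 by rewrite ft0 mulr_gt0//; lra.
have e2 : 0 < e / 2 by rewrite divr_gt0.
have /(_ _ e2) := fr _ at0' t0b' ft0'.
move=> fh.
near (0 : R)^'+ => h.
have h0 : 0 < h by near: h; exact: nbhs_right_gt.
have hb : h <= b - t0 by near: h; apply: nbhs_right_le; rewrite subr_gt0.
have : f (t0 + h) <= f t0 + (0 + e / 2) * h by near: h.
have : 0 < k (t0 + h) by apply: kpos; lra.
rewrite /k => ? ?.
have : e * h > 0 by rewrite mulr_gt0.
nra.
Unshelve. all: by end_near. Qed.

(** Gronwall's integrating factor for Dini bounds: as [f t] is nonnegative, [F * (1 + m * h) <= 1]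
    absorbs the term [m * f t]. *)
Lemma rate_leM_expR f t c m : 0 <= m -> 0 <= f t -> rate_le f t (m * f t + c) ->
  rate_le (fun s => expR (- (m * s)) * f s) t (expR (- (m * t)) * c).
Proof.
move=> m0 ft0 fc e e0.
set E := expR (- (m * t)); have E0 : 0 < E by exact: expR_gt0.
set d := e / (2 * E); have d0 : 0 < d by rewrite divr_gt0// mulr_gt0.
(* The condition [h * q <= d] pays for replacing [F] by 1 in front of [c + d], hence the final slack
   [2 * d]. *)
pose q := `|c + d| * m + 1; have q0 : 0 < q by rewrite ltr_wpDl// mulr_ge0.
have eq0 : 0 < d / q by rewrite divr_gt0.
near=> h.
have h0 : 0 < h by near: h; exact: nbhs_right_gt.
have hq : h * q <= d by rewrite -ler_pdivlMr//; near: h; exact: nbhs_right_le.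
have fh : f (t + h) <= f t + (m * f t + c + d) * h by near: h; exact: fc.
have -> : - (m * (t + h)) = - (m * t) + - (m * h) by ring.
rewrite expRD -/E; set F := expR (- (m * h)).
have F0 : 0 < F by exact: expR_gt0.
have mh : 0 <= m * h by rewrite mulr_ge0// ltW.
have F1 : F * (1 + m * h) <= 1.
  by rewrite /F expRN mulrC ler_pdivrMr ?expR_gt0// mul1r expR_ge1Dx.
have F2 : 1 - m * h <= F by rewrite /F -[X in 1 + X]mulrN1 mulrN1; exact: expR_ge1Dx.
have F3 : F <= 1 by rewrite /F expR_le1 oppr_le0.
rewrite -mulrA; apply: (@le_trans _ _ (E * (f t + (c + 2 * d) * h))); last first.
  rewrite le_eqVlt; apply/orP; left; apply/eqP.
  by rewrite /d; field; rewrite gt_eqF.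
rewrite ler_pM2l//.
apply: (@le_trans _ _ (F * (f t + (m * f t + c + d) * h))).
  by rewrite ler_pM2l.
have -> : F * (f t + (m * f t + c + d) * h) =
  F * (1 + m * h) * f t + F * (c + d) * h by ring.
have : F * (1 + m * h) * f t <= f t by rewrite -[leRHS]mul1r ler_wpM2r.
suff : F * (c + d) * h <= (c + 2 * d) * h by lra.
rewrite ler_pM2r//.
have : (1 - F) * - (c + d) <= m * h * `|c + d|.
  rewrite (le_trans (ler_norm _))// normrM normrN ler_wpM2r//.
  by rewrite ger0_norm; lra.
move: hq; rewrite /q; nra.
Unshelve. all: by end_near. Qed.

(** Chain rule for the square root: a square lies above its tangent, so [f (t + h) ^+ 2 - f t ^+ 2]
    is at least [2 * f t * (f (t + h) - f t)]. *)
Lemma rate_le_div f t c : 0 < f t -> rate_le (fun s => f s ^+ 2) t c ->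
  rate_le f t (c / (2 * f t)).
Proof.
move=> f0 fc e e0.
have d0 : 0 < e * (2 * f t) by rewrite !mulr_gt0.
near=> h.
have h0 : 0 < h by near: h; exact: nbhs_right_gt.
have fh : f (t + h) ^+ 2 <= f t ^+ 2 + (c + e * (2 * f t)) * h by near: h; exact: fc.
rewrite -lerBlDl -(@ler_pM2r _ (2 * f t)) ?mulr_gt0//.
have -> : (c / (2 * f t) + e) * h * (2 * f t) = (c + e * (2 * f t)) * h.
  by field; rewrite gt_eqF.
have := sqr_ge0 (f (t + h) - f t); nra.
Unshelve. all: by end_near. Qed.

Lemma is_derive_expR_sqr (a b c m : R) t :
  is_derive t 1 (fun s => a + b * expR (- (m * s)) + c * s ^+ 2)
    (2 * c * t - m * b * expR (- (m * t))).
Proof.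
have -> : (fun s => a + b * expR (- (m * s)) + c * s ^+ 2) =
    cst a + b \*: (expR \o ((- m) \*: @id R)) + c \*: ((@id R) ^+ 2).
  by apply/funext => s; rewrite -mulNr.
apply: is_derive_eq; rewrite -(mulNr m t) /GRing.scale/= /GRing.scale/=; ring.
Qed.

End dini.

(** * Consequences of the EVI *)

Lemma limf_esup_lt {T : choiceType} {U : filteredType T} {R : realType}
    (f : U -> \bar R) (F : set_system U) (FF : Filter F) (a : \bar R) :
  (limf_esup f F < a)%E -> \forall x \near F, (f x < a)%E.
Proof.
rewrite limf_esupE => /ereal_inf_lt[_ [V FV <-] Va].
by apply: filterS FV => x Vx; apply: le_lt_trans Va; apply: ereal_sup_ubound;
  exists x.
Qed.

Section metric.
Context {R : realType} {X : metricType R}.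
Implicit Types x y z : X.

Lemma mdist_lipschitz x y z : `|mdist x z - mdist y z| <= mdist x y.
Proof.
have := metric_triangle x y z; have := metric_triangle y x z.
by rewrite (metric_sym y x) ler_norml => ? ?; apply/andP; split; lra.
Qed.

Lemma cvg_mdist {T} (F : set_system T) (FF : Filter F) (f : T -> X) x :
  f @ F --> x <-> (forall e, 0 < e -> \forall t \near F, mdist (f t) x < e).
Proof.
split=> [fx e e0|fx].
  have : (f @ F) (ball x e) by apply: fx; exact: nbhsx_ballx.
  by apply: (@filterS _ F _ (f @^-1` ball x e)) => t;
    rewrite /= ballEmdist/= metric_sym.
move=> A /nbhs_ballP[e /= e0 eA]; have := fx _ e0; apply: (@filterS _ F) => t te.
by apply: eA; rewrite ballEmdist/= metric_sym.
Qed.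

Lemma continuous_mdist {T : topologicalType} (f : T -> X) y :
  continuous f -> continuous (fun t => mdist (f t) y).
Proof.
move=> cf t; apply/cvgrPdist_lt => e e0.
have /cvg_mdist/(_ _ e0) := cf t; apply: filterS => s ste.
by apply: le_lt_trans ste; rewrite distrC mdist_lipschitz.
Qed.

End metric.

(** * Integrated EVI, energy decay and contraction of the flow *)

Section flow_evi.
Context {R : realType} {X : metricType R} {phi : X -> \bar R} {lambda : R}
  {D : set X} {S : R -> X -> X}.
Context (phi_proper : proper_functional phi)
  (phi_lsc : lower_semicontinuous phi)
  (S_flow : EVI_gradient_flow lambda phi D S).
Implicit Types (x y w : X) (t h r : R).

Local Notation p x := (fine (phi x)).
(* [EVI_lambda] is only used through the weaker [EVI_(- mu)]; this way
   divisions by [mu] make sense. *)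
Local Notation mu := (`|lambda| + 1).

Lemma mu_gt0 : 0 < mu. Proof. by rewrite ltr_wpDl. Qed.

Lemma fine_phiE x : Dom phi x -> (p x)%:E = phi x.
Proof.
by move=> xD; rewrite fineK// fin_numElt phi_proper.1/=.
Qed.

Lemma fine_phi_lsc x a : Dom phi x -> a < p x ->
  \forall y \near x, Dom phi y -> a < p y.
Proof.
move=> xD ax; have : (a%:E < phi x)%E by rewrite -fine_phiE// lte_fin.
move=> /phi_lsc[V xV Va]; apply: filterS xV => y /Va ay yD.
by rewrite -lte_fin fine_phiE.
Qed.

Lemma flow_Dom x t : D x -> Dom phi x -> 0 <= t -> Dom phi (S t x).
Proof.
move=> Dx xD; rewrite le_eqVlt => /predU1P[<-|t0].
  by rewrite (flow_id S_flow).
exact: EVI_Dom (flow_EVI S_flow Dx) _ t0.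
Qed.

Lemma flow_rate x w t : D x -> 0 < t -> Dom phi w ->
  rate_le (fun s => mdist (S s x) w ^+ 2) t
    (mu * mdist (S t x) w ^+ 2 + 2 * (p w - p (S t x))).
Proof.
move=> Dx t0 wD; have uD := EVI_Dom (flow_EVI S_flow Dx) t0.
have := EVI_ineq (flow_EVI S_flow Dx) t0 wD.
set F := fun _ => _; set c := mu * _ + _.
rewrite -(fine_phiE wD) -(fine_phiE uD) -EFinB => evi.
have Fc : (dini_upper_right F t <= c%:E)%E.
  move: evi; case: (dini_upper_right F t) => [r| |].
  - rewrite -EFinM -EFinD !lee_fin -/(F t) => evi.
    rewrite /c -/(F t).
    have : - lambda * F t <= mu * F t.
      rewrite ler_wpM2r ?sqr_ge0//; have := ler_norm (- lambda).
      by rewrite normrN; lra.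
    lra.
  - by rewrite gt0_muley ?lte_fin ?invr_gt0// addye.
  - by rewrite leNye.
move=> e e0.
have : (dini_upper_right F t < (c + e)%:E)%E.
  by rewrite (le_lt_trans Fc)// lte_fin ltrDl.
move=> /limf_esup_lt ev; near=> h.
have h0 : 0 < h by near: h; exact: nbhs_right_gt.
have : (((F (t + h) - F t) / h)%:E < (c + e)%:E)%E by near: h.
rewrite lte_fin ltr_pdivrMr// => /ltW; rewrite lerBlDl; exact.
Unshelve. all: by end_near. Qed.

(* Extended by the constant [x] to negative times, to get a curve that is
   continuous on the whole line. *)
Definition flow_line x t := S (Num.max 0 t) x.

Lemma flow_lineE x t : 0 <= t -> flow_line x t = S t x.
Proof. by move=> t0; rewrite /flow_line max_r. Qed.

Lemma continuous_flow_line x : D x -> continuous (flow_line x).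
Proof.
move=> Dx t; have [t0|t0|t0] := ltgtP t 0.
- apply: (near_cst_continuous (S 0 x)).
  near=> s; rewrite /flow_line max_l//; apply: ltW; near: s; exact: lt_nbhsl.
- rewrite /continuous_at flow_lineE ?(ltW t0)//.
  apply: (@cvg_trans _ ((fun s => S s x) @ t)).
    apply: near_eq_cvg; near=> s; rewrite flow_lineE//; apply: ltW.
    by near: s; exact: lt_nbhsr.
  apply: (EVI_continuous (flow_EVI S_flow Dx)).
  by rewrite in_itv/= t0.
- rewrite t0 /continuous_at {2}/flow_line maxxx (flow_id S_flow)//.
  apply/cvg_mdist => e e0.
  have /cvg_mdist/(_ _ e0) := flow_cvg0 S_flow Dx.
  rewrite near_withinE; apply: filterS => s se; rewrite /flow_line.
  by case: (ltP 0 s) => s0; [exact: se|rewrite (flow_id S_flow)// mdistxx].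
Unshelve. all: by end_near. Qed.

Lemma flow_line_rate x w t : D x -> 0 < t -> Dom phi w ->
  rate_le (fun s => mdist (flow_line x s) w ^+ 2) t
    (mu * mdist (flow_line x t) w ^+ 2 + 2 * (p w - p (flow_line x t))).
Proof.
move=> Dx t0 wD e e0; rewrite !flow_lineE ?(ltW t0)//.
near=> h; rewrite flow_lineE; last first.
  by rewrite addr_ge0// ltW//; near: h; exact: nbhs_right_gt.
by near: h; exact: flow_rate.
Unshelve. all: by end_near. Qed.

(* The integral of [exp (- mu s)] over [[0, h]]. *)
Definition expint h := (1 - expR (- (mu * h))) / mu.

Lemma expint_ge0 h : 0 <= h -> 0 <= expint h.
Proof.
move=> h0; rewrite divr_ge0 ?(ltW mu_gt0)// subr_ge0 expR_le1 oppr_le0.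
by rewrite mulr_ge0// ltW// mu_gt0.
Qed.

Lemma expint_le h : expint h <= h.
Proof.
rewrite ler_pdivrMr ?mu_gt0// lerBlDr -lerBlDl mulrC.
by have := expR_ge1Dx (- (mu * h)); lra.
Qed.

Lemma expint_ge h : h * expR (- (mu * h)) <= expint h.
Proof.
rewrite ler_pdivlMr ?mu_gt0// lerBrDr expRN -(@ler_pM2r _ (expR (mu * h)))
  ?expR_gt0//.
rewrite mul1r mulrDl mulVf ?gt_eqF ?expR_gt0// mulrAC mulrVK ?unitf_gt0 ?expR_gt0//.
by have := expR_ge1Dx (mu * h); lra.
Qed.

(** The EVI with test point [y], integrated from [0] to [h] with the integrating factor
    [exp (- mu s)]. The weight [expR (mu * r)] cancels that factor, so the part [B * r] integrates
    to exactly [B * h ^+ 2]. *)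
Lemma flow_dist_bound x y h A B : D x -> Dom phi x -> Dom phi y -> 0 <= h ->
  (forall r, 0 < r -> r < h -> p y - p (S r x) <= A + expR (mu * r) * (B * r)) ->
  expR (- (mu * h)) * mdist (S h x) y ^+ 2 <=
    mdist x y ^+ 2 + 2 * expint h * A + B * h ^+ 2.
Proof.
move=> Dx xD yD h0 ub; have m0 := mu_gt0.
(* Minus the bound claimed at time [s], expanded to match [is_derive_expR_sqr]. *)
pose F s := - (mdist x y ^+ 2 + 2 * A / mu) + 2 * A / mu * expR (- (mu * s))
            + (- B) * s ^+ 2.
have FE s : F s = - (mdist x y ^+ 2 + 2 * expint s * A + B * s ^+ 2).
  by rewrite /F /expint; field; rewrite gt_eqF.
suff : expR (- (mu * h)) * mdist (flow_line x h) y ^+ 2 + F h <= 0.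
  by rewrite flow_lineE// FE; lra.
apply: (@le0_of_rate_le0 _ (fun s => _ * mdist (flow_line x s) y ^+ 2 + F s) 0) => //.
- move=> s; apply: cvgD; last first.
    by apply/differentiable_continuous/derivable1_diffP;
      case: (is_derive_expR_sqr (- (mdist x y ^+ 2 + 2 * A / mu)) (2 * A / mu) (- B)
        mu s).
  apply: cvgM; last first.
    apply: (@continuous_comp _ _ _ (fun s => mdist (flow_line x s) y) (fun z =>
      z ^+ 2)).
      by apply: continuous_mdist; exact: continuous_flow_line.
    exact: exprn_continuous.
  apply: continuous_comp; last exact: continuous_expR.
  by apply: cvgN; apply: cvgM; [exact: cvg_cst|exact: cvg_id].
- by rewrite FE flow_lineE// (flow_id S_flow)// mulr0 oppr0 expR0 /expint mulr0
    oppr0 expR0 subrr; lra.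
- move=> t t0 th _; have et := expR_gt0 (- (mu * t)).
  have H1 : rate_le (fun s => expR (- (mu * s)) * mdist (flow_line x s) y ^+ 2) t
      (expR (- (mu * t)) * (2 * (p y - p (flow_line x t)))).
    by apply: rate_leM_expR; [exact: ltW|exact: sqr_ge0|exact: flow_line_rate].
  have H2 := rate_le_derive (is_derive_expR_sqr (- (mdist x y ^+ 2 + 2 * A / mu)) (2
    * A / mu) (- B) mu t).
  apply: rate_le_weaken (rate_leD H1 H2).
  have := ub _ t0 th; rewrite -(flow_lineE x (ltW t0)) -(ler_pM2l et).
  have EE : expR (- (mu * t)) * expR (mu * t) = 1 by rewrite -expRD addNr expR0.
  rewrite [in X in X -> _](_ : _ * (A + _) = expR (- (mu * t)) * A + B * t);
    last first.
    by rewrite mulrDr (mulrA _ _ (B * t)) EE mul1r.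
  have -> : mu * (2 * A / mu) = 2 * A by field; rewrite gt_eqF.
  lra.
Qed.

(** Let [c] be the last time up to [t] with energy at most [p x], attained by lower semicontinuity.
    Beyond [c] the energy exceeds that of [S c x], so the EVI with test point [S c x] keeps the flow
    at this point until [t], although the energy at [t] is larger. *)
Lemma flow_phi_le x t : D x -> Dom phi x -> 0 <= t -> p (S t x) <= p x.
Proof.
move=> Dx xD t0; rewrite leNgt; apply/negP => pxt.
pose A := [set r | 0 <= r <= t /\ p (S r x) <= p x].
have A0 : A 0 by split; rewrite ?lexx// (flow_id S_flow).
have supA : has_sup A by split; [exists 0|exists t => r [/andP[]]].
set c := sup A.
have Ale r : A r -> r <= c by move=> Ar; apply: ub_le_sup Ar; exact: supA.2.
have c0 : 0 <= c by exact: Ale.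
have ct : c <= t by apply: ge_sup; [exact: supA.1|move=> r [/andP[]]].
have pc : p (S c x) <= p x.
  rewrite leNgt; apply/negP => pxc.
  have uD := flow_Dom Dx xD c0; rewrite -flow_lineE// in uD pxc.
  have := @continuous_flow_line _ Dx c _ (fine_phi_lsc uD pxc).
  move=> /nbhs_ballP[d /= d0 dV].
  have [r Ar cr] := sup_adherent d0 supA.
  have /dV : ball c d r.
    rewrite /ball/= ger0_norm ?subr_ge0 ?Ale//.
    by rewrite ltrBlDr addrC -ltrBlDr.
  have r0 : 0 <= r by case: Ar => /andP[].
  rewrite /= flow_lineE// => /(_ (flow_Dom Dx xD r0)).
  by rewrite ltNge Ar.2.
have uD := flow_Dom Dx xD c0; have Du := flow_maps S_flow c0 Dx.
have tc : 0 <= t - c by rewrite subr_ge0.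
have SE r : 0 <= r -> S r (S c x) = S (c + r) x.
  by move=> r0; rewrite (flow_semigroup S_flow).
have /(_ 0 0) := flow_dist_bound Du uD uD tc.
move=> /(_ _)/wrap[r r0 rt|].
  rewrite mul0r mulr0 addr0 SE ?(ltW r0)// subr_le0 (le_trans pc)//.
  rewrite leNgt; apply/negP => /ltW pcr.
  have /Ale : A (c + r) by split => //; apply/andP; split; lra.
  lra.
rewrite mdistxx !mulr0 mul0r expr0n/= !addr0 pmulr_rle0 ?expR_gt0//.
rewrite SE// subrKC => d0.
have /eqP : mdist (S t x) (S c x) ^+ 2 = 0 by apply/eqP; rewrite eq_le d0 sqr_ge0.
rewrite sqrf_eq0 => /eqP /mdist_positivity E.
by move: pxt; rewrite E ltNge pc.
Qed.

(** The energy decays along the flow, so its value at time [h] is the least one and bounds the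
    integrand with [B = 0]. *)
Lemma flow_evi x y h : D x -> Dom phi x -> Dom phi y -> 0 <= h ->
  expR (- (mu * h)) * mdist (S h x) y ^+ 2 <=
    mdist x y ^+ 2 + 2 * expint h * (p y - p (S h x)).
Proof.
move=> Dx xD yD h0.
have := @flow_dist_bound x y h (p y - p (S h x)) 0 Dx xD yD h0.
rewrite mul0r addr0; apply => r r0 rh.
rewrite mul0r mulr0 addr0 lerD2l lerN2.
have r0' := ltW r0; have rh' : 0 <= h - r by rewrite subr_ge0 ltW.
rewrite -{1}(subrKC r h) (flow_semigroup S_flow)//.
by apply: flow_phi_le => //; [exact: flow_maps S_flow _ _ _ _|exact: flow_Dom].
Qed.

(** The two points are moved one after the other: [wh] moves [w] and is tested at [u], [uh] moves
    [u] and is tested at the new point [S h w]. Each costs a factor [E] on the squared distance. The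
    energy of [S h w] cancels up to the factor [1 - E], and what remains is small by lower
    semicontinuity of [phi] at [u] and [w]. *)
Lemma flow_contraction x y t : D x -> D y -> Dom phi x -> Dom phi y -> 0 <= t ->
  mdist (S t x) (S t y) <= expR (mu * t) * mdist x y.
Proof.
move=> Dx Dy xD yD t0; have m0 := mu_gt0.
pose f s := expR (- (mu * s)) * mdist (flow_line x s) (flow_line y s).
have cf : continuous (fun s => mdist (flow_line x s) (flow_line y s)).
  move=> s; apply/cvgrPdist_lt => e e0; have e2 : 0 < e / 2 by rewrite divr_gt0.
  have /cvg_mdist/(_ _ e2) H1 := @continuous_flow_line x Dx s.
  have /cvg_mdist/(_ _ e2) H2 := @continuous_flow_line y Dy s.
  near=> r.
  have h1 : mdist (flow_line x r) (flow_line x s) < e / 2 by near: r.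
  have h2 : mdist (flow_line y r) (flow_line y s) < e / 2 by near: r.
  have := mdist_lipschitz (flow_line x s) (flow_line x r) (flow_line y s).
  have := mdist_lipschitz (flow_line y s) (flow_line y r) (flow_line x r).
  rewrite !(metric_sym _ (flow_line x r)) (metric_sym (flow_line y s) (flow_line y
    r)).
  rewrite !ler_norml => /andP[? ?] /andP[? ?].
  by rewrite ltr_norml; apply/andP; split; lra.
suff : f t ^+ 2 + - mdist x y ^+ 2 <= 0.
  rewrite subr_le0 ler_sqr ?nnegrE ?mulr_ge0 ?expR_ge0 ?mdist_ge0//.
  rewrite /f !flow_lineE// -(ler_pM2l (expR_gt0 (mu * t))) mulrA -expRD.
  by rewrite addrN expR0 mul1r.
apply: (@le0_of_rate_le0 _ (fun s => f s ^+ 2 + - mdist x y ^+ 2) 0) => //.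
- move=> s; apply: cvgD; last exact: cvg_cst.
  apply: (@continuous_comp _ _ _ f (fun z => z ^+ 2)); last exact: exprn_continuous.
  apply: cvgM; last exact: cf.
  apply: continuous_comp; last exact: continuous_expR.
  by apply: cvgN; apply: cvgM; [exact: cvg_cst|exact: cvg_id].
- by rewrite /f !flow_lineE// !(flow_id S_flow)// mulr0 oppr0 expR0 mul1r subrr.
move=> s s0 st _ e e0; have s0' := ltW s0.
set u := S s x; set w := S s y.
have Du : D u := flow_maps S_flow s0' Dx.
have Dw : D w := flow_maps S_flow s0' Dy.
have uD : Dom phi u := flow_Dom Dx xD s0'.
have wD : Dom phi w := flow_Dom Dy yD s0'.
(* Two energy errors of at most [d] each get multiplied by [2 * C <= 2 * h], for a total of at most
   [e * h]. *)
pose d := e / 4; have d0 : 0 < d by rewrite divr_gt0.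
have lscS z : D z -> Dom phi z -> \forall h \near (0 : R)^'+, p z - d < p (S h z).
  move=> Dz zD; have pd : p z - d < p z by rewrite ltrBlDr ltrDl.
  have : \forall h \near (0 : R)^'+, Dom phi (S h z) -> p z - d < p (S h z).
    by have := @flow_cvg0 _ _ _ _ _ _ S_flow z Dz _ (fine_phi_lsc zD pd).
  move=> H; near=> h; have h0 : 0 <= h by near: h; exact: nbhs_right_ge.
  by have : Dom phi (S h z) by [exact: flow_Dom]; near: h.
pose q := mu * (`|p u - p w| + 1); have q0 : 0 < q.
  by rewrite mulr_gt0// ltr_wpDl.
near=> h.
have h0 : 0 < h by near: h; exact: nbhs_right_gt.
have h0' := ltW h0.
have hq : h * q <= d by rewrite -ler_pdivlMr//; near: h; apply: nbhs_right_le;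
  rewrite divr_gt0.
have puh : p u - d < p (S h u) by near: h; exact: lscS.
have pwh : p w - d < p (S h w) by near: h; exact: lscS.
have wh := flow_evi Dw wD uD h0'.
have uh := flow_evi Du uD (flow_Dom Dw wD h0') h0'.
rewrite add0r /f !flow_lineE ?addr_ge0// !(flow_semigroup S_flow)// -/u -/w.
set E := expR (- (mu * h)) in wh uh.
have E0 : 0 < E by exact: expR_gt0.
have E1 : E <= 1 by rewrite expR_le1 oppr_le0 mulr_ge0// ltW.
have E2 : 1 - mu * h <= E by exact: expR_ge1Dx.
have -> : expR (- (mu * (s + h))) = expR (- (mu * s)) * E.
  by rewrite -expRD; congr expR; ring.
set F := expR (- (mu * s)).
have F0 : 0 < F by exact: expR_gt0.
have F1 : F <= 1 by rewrite expR_le1 oppr_le0 mulr_ge0// ltW.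
have C0 := expint_ge0 h0'; have C1 := expint_le h.
set C := expint h in wh uh C0 C1.
rewrite (metric_sym w u) (metric_sym _ u) in wh.
have key : (E * mdist (S h u) (S h w)) ^+ 2 <= mdist u w ^+ 2 + e * h.
  have : E * (E * mdist (S h u) (S h w) ^+ 2) <=
         mdist u w ^+ 2 + 2 * C * (p u - E * p (S h u) - (1 - E) * p (S h w)).
    have := ler_wpM2l (ltW E0) uh; move: wh; lra.
  have : p u - E * p (S h u) - (1 - E) * p (S h w) <= d + (1 - E) * (p u - p w).
    have := ler_wpM2l (ltW E0) (ltW puh).
    have : 0 <= 1 - E by lra.
    move=> /ler_wpM2l/(_ _ _ (ltW pwh)); lra.
  have : (1 - E) * (p u - p w) <= d.
    apply: le_trans hq; rewrite /q.
    have : (1 - E) * (p u - p w) <= (1 - E) * `|p u - p w|.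
      by rewrite ler_wpM2l ?ler_norm// subr_ge0.
    have : (1 - E) * `|p u - p w| <= (mu * h) * `|p u - p w|.
      by rewrite ler_wpM2r//; lra.
    have : 0 <= h * mu by rewrite mulr_ge0// ltW.
    lra.
  move: C0 C1; rewrite /d => ? ? ? H1 H2.
  rewrite exprMn; nra.
rewrite -mulrA exprMn (exprMn _ F).
have : F ^+ 2 <= 1 by rewrite expr_le1// ltW.
have : 0 <= F ^+ 2 by exact: sqr_ge0.
have : 0 <= e * h by rewrite mulr_ge0// ltW.
move: key; nra.
Unshelve. all: by end_near. Qed.

End flow_evi.

(** * Slope, speed of the flow and the sharp one-step estimate *)

Section flow_slope.
Context {R : realType} {X : metricType R} {phi : X -> \bar R} {lambda : R}
  {D : set X} {S : R -> X -> X}.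
Context (phi_proper : proper_functional phi)
  (phi_lsc : lower_semicontinuous phi)
  (S_flow : EVI_gradient_flow lambda phi D S).
Implicit Types (x y w : X) (t h r : R).

Local Notation p x := (fine (phi x)).
Local Notation mu := (`|lambda| + 1).
Local Notation expint := (@expint _ lambda).
Local Notation mu_gt0 := (@mu_gt0 _ lambda).
Local Notation flow_line := (@flow_line _ _ S).

(** Tested at [x], the EVI bounds the rate of the squared distance by [2 * mu * g ^+ 2 + 2 * K * g],
    with [g] the distance to [x]; dividing by [2 * g] leaves [mu * g + K]. The comparison only looks
    at times where [f], and so [g], is positive. *)
Lemma flow_speed x h K : D x -> Dom phi x -> 0 <= h -> 0 <= K ->
  (forall r, 0 < r -> r < h ->
    p x - p (S r x) <= K * mdist (S r x) x + mu / 2 * mdist (S r x) x ^+ 2) ->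
  mdist (S h x) x <= K * h * expR (mu * h).
Proof.
move=> Dx xD h0 K0 ub; have m0 := mu_gt0.
pose f s := expR (- (mu * s)) * mdist (flow_line x s) x - K * s.
suff : f h <= 0.
  rewrite subr_le0 flow_lineE// -(ler_pM2r (expR_gt0 (mu * h))) mulrAC -expRD.
  by rewrite addNr expR0 mul1r.
apply: (@le0_of_rate_le0 _ f 0) => //.
- move=> s; apply: cvgB; last by apply: cvgM; [exact: cvg_cst|exact: cvg_id].
  apply: cvgM; last by apply: continuous_mdist; exact: (continuous_flow_line S_flow).
  apply: continuous_comp; last exact: continuous_expR.
  by apply: cvgN; apply: cvgM; [exact: cvg_cst|exact: cvg_id].
- by rewrite /f flow_lineE// (flow_id S_flow)// mdistxx mulr0 mulr0 subrr.
move=> s s0 sh fs0.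
have g0 : 0 < mdist (flow_line x s) x.
  move: fs0; rewrite /f subr_gt0 => /(le_lt_trans (mulr_ge0 K0 (ltW s0))).
  by rewrite pmulr_rgt0 ?expR_gt0.
have := rate_le_div g0 (flow_line_rate phi_proper S_flow Dx s0 xD).
set c := _ / _ => H1.
have cK : c <= mu * mdist (flow_line x s) x + K.
  rewrite /c ler_pdivrMr ?mulr_gt0//.
  have := ub s s0 sh; rewrite flow_lineE ?(ltW s0)//; lra.
have H2 := rate_leM_expR (ltW m0) (ltW g0) (rate_le_weaken cK H1).
have H3 : rate_le (fun s => - (K * s)) s (- K).
  by move=> e e0; near=> k; have k0 : 0 < k by [near: k; exact: nbhs_right_gt]; nra.
apply: rate_le_weaken (rate_leD H2 H3).
rewrite subr_le0 ler_piMl// expR_le1 oppr_le0 mulr_ge0// ltW//.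
Unshelve. all: by end_near. Qed.

(** By time [r] the flow has moved by about [K * r], so it has lost at most about [K ^+ 2 * r] of
    energy. This is the [B * r] of [flow_dist_bound], with [A = p y - p x]; to leading order the
    last term is [K ^+ 2 * h ^+ 2] with constant one. *)
Lemma flow_step x y h K : D x -> Dom phi x -> Dom phi y -> 0 <= h -> 0 <= K ->
  (forall r, 0 < r -> r < h ->
    p x - p (S r x) <= K * mdist (S r x) x + mu / 2 * mdist (S r x) x ^+ 2) ->
  expR (- (mu * h)) * mdist (S h x) y ^+ 2 <=
    mdist x y ^+ 2 + 2 * expint h * (p y - p x)
      + K ^+ 2 * (1 + mu * h * expR (mu * h)) * h ^+ 2.
Proof.
move=> Dx xD yD h0 K0 ub; have m0 := mu_gt0.
apply: (flow_dist_bound phi_proper S_flow) => // r r0 rh.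
have : mdist (S r x) x <= K * r * expR (mu * r).
  apply: flow_speed => //; first exact: ltW.
  by move=> s s0 sr; apply: ub => //; exact: lt_trans rh.
have := ub r r0 rh; have := mdist_ge0 (S r x) x.
set d := mdist _ _; set E := expR (mu * r) => d0 pd dK.
have E1 : 1 <= E by rewrite /E -expR0 ler_expR mulr_ge0// ltW.
have : r * E <= h * expR (mu * h).
  by apply: ler_pM; rewrite ?expR_ge0 ?ler_expR ?(ltW r0) ?(ltW rh)// ler_wpM2l
    ?(ltW rh)// ltW.
set H := h * expR (mu * h) => rEH.
have d2 : d ^+ 2 <= (K * r * E) ^+ 2 by rewrite ler_sqr ?nnegrE// (le_trans d0).
have -> : p y - p (S r x) = (p y - p x) + (p x - p (S r x)) by ring.
rewrite lerD2l (le_trans pd)//.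
have : K * d <= E * (K ^+ 2 * r) by have := ler_wpM2l K0 dK; lra.
have : mu / 2 * d ^+ 2 <= E * (K ^+ 2 * r) * (mu * (r * E)).
  have : 0 <= mu * (K * r * E) ^+ 2 by rewrite mulr_ge0 ?sqr_ge0// ltW.
  have := ler_wpM2l (ltW m0) d2; lra.
have : E * (K ^+ 2 * r) * (mu * (r * E)) <= E * (K ^+ 2 * r) * (mu * H).
  rewrite ler_wpM2l//; last by rewrite ler_pM2l.
  by rewrite !mulr_ge0 ?sqr_ge0 ?expR_ge0// ltW.
rewrite /H; lra.
Qed.

Lemma metric_slope_near x K : Dom phi x -> 0 <= K -> (metric_slope phi x < K%:E)%E ->
  \forall y \near x, Dom phi y -> p x - p y <= K * mdist x y.
Proof.
move=> xD K0; rewrite /metric_slope; case: asboolP => // _.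
case: asboolP => [[_ [V xV VT]] _|_ /limf_esup_lt].
  near=> y => _; have : (V `&` [set: X]) y by split=> //; near: y.
  by rewrite VT => ->; rewrite subrr mdistxx mulr0.
rewrite /dnbhs near_withinE; apply: filterS => y yK yD.
have [->|yx] := eqVneq y x; first by rewrite subrr mdistxx mulr0.
move: (yK yx); rewrite -(fine_phiE phi_proper xD) -(fine_phiE phi_proper yD).
rewrite -EFinB -EFin_max -EFinM lte_fin ltr_pdivrMr ?mdist_gt0 1?eq_sym// => /ltW.
by apply: le_trans; rewrite le_max lexx.
Unshelve. all: by end_near. Qed.

(* The EVI upgrades the local information carried by the slope to a global
   bound, with the sharp constant. *)
Lemma metric_slope_global x y K : D x -> Dom phi x -> Dom phi y -> 0 <= K ->
  (metric_slope phi x < K%:E)%E ->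
  p x - p y <= K * mdist x y + mu / 2 * mdist x y ^+ 2.
Proof.
move=> Dx xD yD K0 /(metric_slope_near xD K0) sK; have m0 := mu_gt0.
set a := mdist x y; have a0 : 0 <= a := mdist_ge0 x y.
rewrite leNgt; apply/negP => lt.
(* The bound on [p x - p y - mu / 2 * a ^+ 2] that running the flow for time [h] yields; it tends to
   [a * K]. *)
pose G h := expR (mu * h) * (a * K + K ^+ 2 * (1 + mu * h * expR (mu * h)) * h / 2).
have cE : continuous (fun h : R => expR (mu * h)).
  move=> h; apply: continuous_comp; last exact: continuous_expR.
  by apply: cvgM; [exact: cvg_cst|exact: cvg_id].
have cG : G h @[h --> (0 : R)^'+] --> G 0.
  apply: cvg_at_right_filter; apply: cvgM; first exact: cE.
  apply: cvgD; first exact: cvg_cst.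
  apply: cvgM; last exact: cvg_cst.
  apply: cvgM; last exact: cvg_id.
  apply: cvgM; first exact: cvg_cst.
  apply: cvgD; first exact: cvg_cst.
  apply: cvgM; last exact: cE.
  by apply: cvgM; [exact: cvg_cst|exact: cvg_id].
have G0 : G 0 < p x - p y - mu / 2 * a ^+ 2.
  by rewrite /G !mulr0 expR0 !mul0r; lra.
have sN : \forall r \near (0 : R)^'+,
    Dom phi (S r x) -> p x - p (S r x) <= K * mdist x (S r x).
  by have := @flow_cvg0 _ _ _ _ _ _ S_flow x Dx _ sK.
have [r0 /= r00 r0P] := sN.
near (0 : R)^'+ => h.
have h0 : 0 < h by near: h; exact: nbhs_right_gt.
have hr0 : h < r0 by near: h; exact: nbhs_right_lt.
have h0' := ltW h0.
have ub r : 0 < r -> r < h ->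
    p x - p (S r x) <= K * mdist (S r x) x + mu / 2 * mdist (S r x) x ^+ 2.
  move=> rp rh.
  have := r0P r; rewrite /= sub0r normrN gtr0_norm// => /(_ (lt_trans rh hr0) rp).
  move=> /(_ (flow_Dom S_flow Dx xD (ltW rp))); rewrite metric_sym => H.
  by rewrite (le_trans H)// lerDl mulr_ge0 ?sqr_ge0// divr_ge0// ltW.
have st := flow_step Dx xD yD h0' K0 ub.
have sp := flow_speed Dx xD h0' K0 ub.
have Gh : G h < p x - p y - mu / 2 * a ^+ 2.
  by near: h; apply: cvgr_lt cG _ G0.
(* Turns the loss [(1 - E') * a ^+ 2] into [mu * C * a ^+ 2]; after division by [2 * C] this is the
   [mu / 2] of the statement. *)
have CE : mu * expint h = 1 - expR (- (mu * h)).
  by rewrite /expint mulrC divfK// gt_eqF.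
have C1 := @expint_ge _ lambda h.
move: st sp Gh C1; rewrite /G -/a.
set C := expint h in CE *; set M := _ * (1 + _); set E' := expR (- (mu * h)) in CE *.
set E := expR (mu * h); set b := mdist (S h x) y; set c := mdist (S h x) x.
have EE : E' * E = 1 by rewrite -expRD addNr expR0.
have E'0 : 0 < E' by exact: expR_gt0.
have E0 : 0 < E by exact: expR_gt0.
have b0 : 0 <= b := mdist_ge0 _ _; have c0 : 0 <= c := mdist_ge0 _ _.
have abc : a <= b + c.
  by rewrite /a /b /c addrC (metric_sym _ x) metric_triangle.
move=> st sp Gh C1.
have M0 : 0 <= M.
  by rewrite mulr_ge0 ?sqr_ge0// addr_ge0// mulr_ge0 ?expR_ge0// mulr_ge0// ltW.
have cb : a ^+ 2 - 2 * a * c <= b ^+ 2.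
  have [ac|ac] := leP a c; nra.
have Ec : E' * c <= K * h.
  have := ler_wpM2l (ltW E'0) sp.
  by rewrite mulrCA EE mulr1.
have H1 : 2 * C * (p x - p y) <= mu * C * a ^+ 2 + 2 * a * (K * h) + M * h ^+ 2.
  have := ler_wpM2l (ltW E'0) cb.
  have := ler_wpM2l (mulr_ge0 (ler0n _ 2) a0) Ec.
  move: st CE; nra.
have C0 : 0 < C by apply: lt_le_trans C1; rewrite mulr_gt0.
have hEC : h <= E * C.
  by have := ler_wpM2l (ltW E0) C1; rewrite mulrCA (mulrC E) EE mulr1.
have H2 : h * (a * K + M * h / 2) <= E * C * (a * K + M * h / 2).
  rewrite ler_wpM2r//; apply: addr_ge0; first exact: mulr_ge0.
  by apply: divr_ge0 => //; exact: mulr_ge0.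
have : C * (E * (a * K + M * h / 2)) < C * (p x - p y - mu / 2 * a ^+ 2).
  by rewrite ltr_pM2l.
move: H1 H2; lra.
Unshelve. all: by end_near. Qed.

End flow_slope.

Section metric_slope.
Context {R : realType} {X : metricType R} {phi : X -> \bar R}.

Lemma metric_slope_ge0 x : (0 <= metric_slope phi x)%E.
Proof.
rewrite /metric_slope; case: asboolP => [_|_]; first exact: leey.
case: asboolP => // xi; apply: limf_esup_ge0.
  rewrite /dnbhs withinE/= => -[V xV VE]; apply: xi; split; first by rewrite inE.
  exists V => //; rewrite setIT; apply/seteqP; split => y /=; last first.
    by move=> ->; exact: nbhs_singleton.
  move=> Vy; apply: contrapT => /eqP yx.
  have : (V `&` [set y | y != x]) y by split.
  by rewrite -VE => -[].
move=> y; apply: mule_ge0; first by rewrite le_max lexx orbT.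
by rewrite lee_fin invr_ge0 mdist_ge0.
Qed.

End metric_slope.

(** * The global slope and its semicontinuity *)

Section global_slope.
Context {R : realType} {X : metricType R} {phi : X -> \bar R} {lambda : R}
  {D : set X} {S : R -> X -> X}.
Context (phi_proper : proper_functional phi)
  (phi_lsc : lower_semicontinuous phi)
  (S_flow : EVI_gradient_flow lambda phi D S).
Implicit Types (x y w : X) (t h r : R).

Local Notation p x := (fine (phi x)).
Local Notation mu := (`|lambda| + 1).
Local Notation mu_gt0 := (@mu_gt0 _ lambda).

(** For [y] at distance [d > 0] from [x], the condition says that [K] dominates the positive part of
    [(p x - p y) / d - mu / 2 * d]: the least such [K] is the usual global slope, and the form
    without quotient covers [y = x] as well. *)
Definition slope_bound x (K : R) := 0 <= K /\ forall y, Dom phi y ->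
  p x - p y <= K * mdist x y + mu / 2 * mdist x y ^+ 2.

(* Unlike [metric_slope], it is lower semicontinuous, hence measurable along
   curves. *)
Definition global_slope x : \bar R :=
  ereal_inf [set K%:E | K in slope_bound x].

Lemma global_slope_ge0 x : (0 <= global_slope x)%E.
Proof. by apply: le_ereal_inf_tmp => _ [K [K0 _] <-]; rewrite lee_fin. Qed.

(** The infimum is attained, since for fixed [y] the condition on [K] is closed. *)
Lemma global_slope_bound x K : global_slope x = K%:E -> slope_bound x K.
Proof.
move=> xK; split; first by rewrite -lee_fin -xK global_slope_ge0.
move=> y yD; apply/ler_addgt0Pr => e e0.
have d1 : 0 < mdist x y + 1 by rewrite ltr_wpDl ?mdist_ge0.
have : (global_slope x < (K + e / (mdist x y + 1))%:E)%E.
  by rewrite xK lte_fin ltrDl divr_gt0.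
move=> /ereal_inf_lt[_ [K' [K'0 /(_ _ yD)] K'y <-]]; rewrite lte_fin => /ltW K'K.
rewrite (le_trans K'y)// [leRHS]addrAC lerD2r.
have := ler_wpM2r (mdist_ge0 x y) K'K; move=> /le_trans; apply.
rewrite mulrDl lerD2l mulrAC ler_pdivrMr//; have := mdist_ge0 x y; nra.
Qed.

Lemma global_slope_le x : D x -> Dom phi x ->
  (global_slope x <= metric_slope phi x)%E.
Proof.
move=> Dx xD; have := metric_slope_ge0 (phi := phi) x.
case sE : (metric_slope phi x) => [s| |]; [|by move=> _;
  exact: leey|by rewrite leeNy_eq].
rewrite lee_fin => s0; apply/lee_addgt0Pr => e e0.
apply: ereal_inf_lbound; exists (s + e) => //.
have se : 0 <= s + e by rewrite addr_ge0// ltW.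
split => // y yD; apply: (metric_slope_global phi_proper S_flow) => //.
by rewrite sE lte_fin ltrDl.
Qed.

(** A failure of [slope_bound (f t) b] is witnessed by a single [y], and the failing inequality for
    this [y] persists at nearby times, by continuity of [f] and lower semicontinuity of [phi]. *)
Lemma lsc_global_slope (f : R -> X) : continuous f -> (forall t, Dom phi (f t)) ->
  lower_semicontinuous (fun t => global_slope (f t)).
Proof.
move=> cf fD t a aG; have m0 := mu_gt0.
have [a0|a0] := ltP a 0.
  exists setT; first exact: filterT.
  by move=> s _; rewrite (@lt_le_trans _ _ 0%E) ?lte_fin ?global_slope_ge0.
(* The nearby infima are only shown to be at least [b], so [b] has to lie strictly above [a]. *)
have [b ab bG] : exists2 b, a < b & (b%:E < global_slope (f t))%E.
  case: (global_slope (f t)) aG => [g| |]//; rewrite ?lte_fin => ag.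
    by exists ((a + g) / 2); rewrite ?lte_fin; lra.
  by exists (a + 1); rewrite ?ltrDl ?ltry.
have b0 : 0 <= b by rewrite (le_trans a0)// ltW.
have : ~ slope_bound (f t) b.
  move=> fb; move: bG; apply/negP; rewrite -leNgt.
  by apply: ereal_inf_lbound; exists b.
move=> /not_andP[//|/existsNP[y /not_implyP[yD /negP]]]; rewrite -ltNge => lt.
pose F s := p y + (b * mdist (f s) y + mu / 2 * mdist (f s) y ^+ 2).
have cF : continuous F.
  have cd := continuous_mdist (y := y) cf.
  move=> s; apply: cvgD; first exact: cvg_cst.
  apply: cvgD; first by apply: cvgM; [exact: cvg_cst|exact: cd].
  apply: cvgM; first exact: cvg_cst.
  by apply: (@continuous_comp _ _ _ (fun s => mdist (f s) y) (fun z => z ^+ 2));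
    [exact: cd|exact: exprn_continuous].
have [c Fc cp] : exists2 c, F t < c & c < p (f t).
  exists ((F t + p (f t)) / 2); rewrite /F; lra.
have H1 : \forall s \near t, F s < c.
  by move/cvgr_lt : (cF t) => /(_ _ Fc).
have H2 : \forall s \near t, Dom phi (f s) -> c < p (f s).
  exact: (cf t _ (fine_phi_lsc phi_proper phi_lsc (fD t) cp)).
exists [set s | F s < c /\ c < p (f s)].
  by apply: filterS2 H1 H2 => s ? H; split => //; exact: H.
move=> s [Fs cs]; rewrite (@lt_le_trans _ _ b%:E) ?lte_fin//.
apply: le_ereal_inf_tmp => _ [K [K0 fK] <-]; rewrite lee_fin leNgt; apply/negP =>
  /ltW Kb.
have := fK _ yD; have := ler_wpM2r (mdist_ge0 (f s) y) Kb.
move: Fs cs; rewrite /F; lra.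
Qed.

End global_slope.

(** * Comparison of the flow with a sequence of points *)

Section discrete_flow.
Context {R : realType} {X : metricType R} {phi : X -> \bar R} {lambda : R}
  {D : set X} {S : R -> X -> X}.
Context (phi_proper : proper_functional phi)
  (phi_lsc : lower_semicontinuous phi)
  (S_flow : EVI_gradient_flow lambda phi D S).
Implicit Types (x y w : X) (t h r : R).

Local Notation p x := (fine (phi x)).
Local Notation mu := (`|lambda| + 1).
Local Notation mu_gt0 := (@mu_gt0 _ lambda).
Local Notation expint := (@expint _ lambda).
Local Notation slope_bound := (@slope_bound _ _ phi lambda).

(** In the sum of [flow_step], [A] controls the squared distances, [B] the slopes, and the energies
    telescope. [e] is the free weight in Young's inequality, which stands in for Cauchy-Schwarz: if
    the bracket divided by [e] is of order [e ^+ 2], the whole bound is of order [e]. *)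
Lemma flow_discrete n h (x : nat -> X) (K : nat -> R) A B e :
  0 < h -> 0 < e ->
  (forall k, D (x k)) -> (forall k, Dom phi (x k)) ->
  (forall k, (k < n)%N -> slope_bound (x k) (K k)) ->
  \sum_(k < n) mdist (x k) (x k.+1) ^+ 2 / h <= A ->
  h * \sum_(k < n) K k ^+ 2 <= B ->
  expR (- (mu * (n%:R * h))) * mdist (S (n%:R * h) (x 0%N)) (x n) <=
    ((A + 2 * (expint h / h) * (p (x n) - p (x 0%N))
        + (1 + mu * h * expR (mu * h)) * B) / e + n%:R * h * e) / 2.
Proof.
move=> h0 e0 Dx xD sK sA sB; have m0 := mu_gt0; have h0' := ltW h0.
set q := mu * h * expR (mu * h).
have q0 : 0 <= q by rewrite mulr_ge0 ?expR_ge0// mulr_ge0// ltW.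
pose E := expR (- (mu * h)).
have E0 : 0 < E by exact: expR_gt0.
have E1 : E <= 1 by rewrite expR_le1 oppr_le0 mulr_ge0// ltW.
pose d k := mdist (S h (x k)) (x k.+1).
have step k : (k < n)%N -> E * d k ^+ 2 <=
    mdist (x k) (x k.+1) ^+ 2 + 2 * expint h * (p (x k.+1) - p (x k))
      + K k ^+ 2 * (1 + q) * h ^+ 2.
  move=> kn; have [K0 Kb] := sK _ kn.
  apply: (flow_step phi_proper S_flow) => // r r0 rh.
  rewrite (metric_sym _ (x k)); apply: Kb.
  by apply: (flow_Dom S_flow) => //; exact: ltW.
have sumd : \sum_(k < n) E * d k ^+ 2 <= h * (A + 2 * (expint h / h) * (p (x n) - p
  (x 0%N)) + (1 + q) * B).
  have gen m : (m <= n)%N -> \sum_(k < m) E * d k ^+ 2 <=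
      \sum_(k < m) mdist (x k) (x k.+1) ^+ 2
      + 2 * expint h * (p (x m) - p (x 0%N)) + (1 + q) * h ^+ 2 * \sum_(k < m) K k
        ^+ 2.
    elim: m => [_|m IH mn]; first by rewrite !big_ord0 subrr !mulr0 !addr0.
    rewrite !big_ord_recr/=; have := IH (ltnW mn); have := step _ mn; lra.
  have := gen n (leqnn n).
  rewrite -mulr_suml ler_pdivrMr// in sA.
  have := ler_wpM2l h0' sB; have : 0 <= 1 + q by rewrite addr_ge0.
  move=> /ler_wpM2l/[apply] HB.
  have -> : h * (A + 2 * (expint h / h) * (p (x n) - p (x 0%N)) + (1 + q) * B) =
      A * h + 2 * expint h * (p (x n) - p (x 0%N)) + (1 + q) * (h * B).
    by field; rewrite gt_eqF.
  move: sA HB; lra.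
(* The deviation reached at step [m] is carried through the next step by the contraction, and [d m]
   is the fresh error; surplus factors [F <= 1] are dropped. *)
have contr : expR (- (mu * (n%:R * h))) * mdist (S (n%:R * h) (x 0%N)) (x n) <=
    \sum_(k < n) E * d k.
  elim: {sK sA sB step sumd} n => [|m IH].
    by rewrite !mul0r (flow_id S_flow)// mdistxx mulr0 big_ord0.
  have mh0 : 0 <= m%:R * h by rewrite mulr_ge0.
  have -> : m.+1%:R * h = m%:R * h + h by rewrite mulrSr mulrDl mul1r.
  rewrite (flow_semigroup S_flow)//.
  rewrite big_ord_recr/= mulrDr opprD expRD -/E.
  set F := expR (- (mu * (m%:R * h))) in IH *.
  have F0 : 0 < F by exact: expR_gt0.
  have F1 : F <= 1 by rewrite expR_le1 oppr_le0 mulr_ge0// ltW.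
  have u := flow_maps S_flow mh0 (Dx 0%N).
  have uD := flow_Dom S_flow (Dx 0%N) (xD 0%N) mh0.
  have := flow_contraction phi_proper phi_lsc S_flow u (Dx m) uD (xD m) h0'.
  have := metric_triangle (S h (S (m%:R * h) (x 0%N))) (S h (x m)) (x m.+1).
  rewrite -/(d m); set a := mdist _ (x m.+1); set b := mdist (S h _) _.
  set c := mdist _ (x m) in IH *.
  have EE : E * expR (mu * h) = 1 by rewrite -expRD addNr expR0.
  move=> abd bc.
  have : F * E * a <= F * (E * b) + F * (E * d m).
    rewrite -mulrDr -mulrDr mulrA ler_wpM2l// ltW// mulr_gt0//.
  have : F * (E * b) <= F * c.
    rewrite ler_pM2l//; have := ler_wpM2l (ltW E0) bc.
    by rewrite mulrA EE mul1r.
  have : F * (E * d m) <= E * d m.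
    by rewrite ler_piMl// mulr_ge0 ?mdist_ge0// ltW.
  move: IH; lra.
apply: (le_trans contr).
have : \sum_(k < n) E * d k <= \sum_(k < n) (E * d k ^+ 2 / (h * e) + h * e) / 2.
  apply: ler_sum => k _; rewrite ler_pdivlMr//.
  have he : 0 < h * e by rewrite mulr_gt0.
  rewrite -(@ler_pM2r _ (h * e))// [leRHS]mulrDl divfK ?gt_eqF//.
  have := sqr_ge0 (d (nat_of_ord k) - h * e); have : 0 <= (1 - E) * (h * e) ^+ 2.
    by rewrite mulr_ge0 ?sqr_ge0// subr_ge0.
  move=> H1 /(ler_wpM2l (ltW E0)); lra.
move=> /le_trans; apply; rewrite -mulr_suml ler_wpM2r// big_split/=.
have -> : \sum_(i < n) h * e = n%:R * h * e.
  by rewrite sumr_const card_ord -mulrA mulr_natl.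
rewrite lerD2r -mulr_suml.
set Z := \sum_(_ < n) _ in sumd *; have -> : Z / (h * e) = Z / h / e.
  by rewrite -mulrA -invfM.
by rewrite ler_wpM2r ?invr_ge0 ?(ltW e0)// ler_pdivrMr// mulrC.
Qed.

End discrete_flow.

(** * Metric derivative of absolutely continuous curves *)

Section absolutely_continuous.
Context {R : realType}.
Local Notation leb := (@lebesgue_measure R).
Implicit Types (f g m : R -> R) (s t : R).

Definition integrableR f := leb.-integrable [set: R] (EFin \o f).

Lemma Rintegral_itvcc f s t : integrableR f -> s <= t ->
  \int[leb]_(x in `]-oo, t]) f x - \int[leb]_(x in `]-oo, s]) f x =
  \int[leb]_(x in `[s, t]) f x.
Proof.
move=> fi st; have fiI (I : interval R) : leb.-integrable [set` I] (EFin \o f).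
  exact: integrableS fi.
rewrite Rintegral_itvB//.
by rewrite Rintegral_itv_obnd_cbnd.
Qed.

Lemma continuous_Rintegral f : integrableR f ->
  continuous (fun t => \int[leb]_(x in `]-oo, t]) f x).
Proof.
move=> fi t; set M := fun t => _.
have ab : t - 1 < t + 1 by lra.
have fI : leb.-integrable `[t - 1, t + 1] (EFin \o f) by exact: integrableS fi.
have /(continuous_within_itvP _ ab)[+ _ _] :=
  parameterized_integral_continuous (ltW ab) fI.
move=> /(_ t); rewrite in_itv/= => /(_ _)/wrap[|ct]; first by apply/andP; split; lra.
have ME s : t - 1 < s -> M s = M (t - 1) + parameterized_integral leb (t - 1) s f.
  move=> ts; rewrite /parameterized_integral -Rintegral_itvcc ?(ltW ts)//.
  by rewrite subrKC.
rewrite /continuous_at (ME t); last lra.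
have : (fun s => M (t - 1) + parameterized_integral leb (t - 1) s f) @ t -->
    M (t - 1) + parameterized_integral leb (t - 1) t f.
  by apply: cvgD; [exact: cvg_cst|exact: ct].
apply: cvg_trans; apply: near_eq_cvg; near=> s.
have ts : t - 1 < s by near: s; apply: lt_nbhsr; lra.
by rewrite /M/= -(ME s ts).
Unshelve. all: by end_near. Qed.

Lemma LS_measure_itv (F : cumulative R R) s t : s <= t ->
  lebesgue_stieltjes_measure F `]s, t] = (F t - F s)%:E.
Proof.
move=> st; rewrite /lebesgue_stieltjes_measure/= /measure_extension.
rewrite measurable_mu_extE/=; last by exists (s, t).
by rewrite wlength_itv_bnd.
Qed.

(* Both [M + f] and [M - f] are nondecreasing, where [M] is a primitive of [m],
   and their Stieltjes measures add up to [2 m] times Lebesgue; so the former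
   has a Radon-Nikodym density. *)
Lemma AC_density m f : integrableR m -> (forall x, 0 <= m x) ->
  (forall s t, s <= t -> `|f t - f s| <= \int[leb]_(x in `[s, t]) m x) ->
  exists2 g, integrableR g &
    forall s t, s <= t -> f t - f s = \int[leb]_(x in `[s, t]) g x.
Proof.
move=> mi m0 fm.
pose M t := \int[leb]_(x in `]-oo, t]) m x.
have ME s t : s <= t -> M t - M s = \int[leb]_(x in `[s, t]) m x.
  exact: Rintegral_itvcc.
have MR s : M x @[x --> s^'+] --> M s.
  by apply: cvg_at_right_filter; exact: continuous_Rintegral.
(* One construction for three cumulative functions: [M + f], [M - f] and their sum [2 * M]. *)
have build (c e : R) : `|e| <= c ->
  exists2 F : cumulative R R, forall t, F t = c * M t + e * f t & True.
  move=> ec.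
  have nd : nondecreasing (fun t => c * M t + e * f t).
    move=> s t st; have := fm s t st; rewrite -ME// => fst.
    have : `|e * (f t - f s)| <= c * (M t - M s) by rewrite normrM ler_pM.
    have := ler_norm (- (e * (f t - f s))); rewrite normrN; lra.
  have rc : right_continuous (fun t => c * M t + e * f t).
    move=> s; apply: cvgD; first by apply: cvgM; [exact: cvg_cst|exact: MR].
    apply: cvgM; first exact: cvg_cst.
    apply/cvgrPdist_le => d d0; near=> x.
    have sx : s <= x by near: x; exact: nbhs_right_ge.
    rewrite distrC (le_trans (fm _ _ sx))// -ME//.
    rewrite (le_trans (ler_norm _))// distrC; near: x.
    by move/cvgrPdist_le : (MR s) => /(_ _ d0).
  by exists (HB.pack_for (cumulative R R) (fun t => c * M t + e * f t)
    (isCumulative.Build R _ _ _ nd rc)).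
have [F FE _] := build 1 1 ltac:(by rewrite normr1).
have [G GE _] := build 1 (- 1) ltac:(by rewrite normrN normr1).
have [H HE _] := build 2 0 ltac:(by rewrite normr0).
have m2i : integrableR (fun x => 2 * m x).
  have := integrableZl measurableT 2 mi; exact.
pose kap (A : set (measurableTypeR R)) := (\int[leb]_(x in A) (2 * m x)%:E)%E.
have miI (I : interval R) : leb.-integrable [set` I] (EFin \o m).
  exact: integrableS mi.
have m2iI A : measurable A -> leb.-integrable A (EFin \o (fun x => 2 * m x)).
  by move=> mA; exact: integrableS m2i.
have m2_ge0 x : (0 <= (2 * m x)%:E)%E by rewrite lee_fin mulr_ge0.
have kap0 : kap set0 = 0%E by rewrite /kap integral_set0.
have kap_ge0 A : (0 <= kap A)%E by exact: integral_ge0.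
have kapS : semi_sigma_additive kap.
  apply: (@semi_sigma_additive_nng_induced _ _ _ leb (EFin \o (fun x => 2 * m x)));
    last exact: m2_ge0.
  exact: measurable_int m2i.
pose kapM : {measure set (measurableTypeR R) -> \bar R} :=
  HB.pack_for {measure set (measurableTypeR R) -> \bar R} kap
    (isMeasure.Build _ _ _ kap kap0 kap_ge0 kapS).
pose nu := lebesgue_stieltjes_measure F.
have HF A : measurable A -> lebesgue_stieltjes_measure H A =
    measure_add (lebesgue_stieltjes_measure F) (lebesgue_stieltjes_measure G) A.
  apply: lebesgue_stieltjes_measure_unique => _ [[a b] _ <-].
  apply/esym; etransitivity; first exact: measure_addE.
  have [ab|ba] := leP a b.
    rewrite /= !LS_measure_itv// -EFinD HE HE FE FE GE GE.
    by congr EFin; ring.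
  by rewrite set_itv_ge -?leNgt ?bnd_simp ?ltW// !measure0 adde0.
have Hkap A : measurable A -> lebesgue_stieltjes_measure H A = kapM A.
  apply: lebesgue_stieltjes_measure_unique => _ [[a b] _ <-].
  have [ab|ba] := leP a b; last first.
    by rewrite set_itv_ge -?leNgt ?bnd_simp ?ltW// !measure0.
  rewrite /= LS_measure_itv// !HE !mul0r !addr0 -mulrBr ME//.
  rewrite -Rintegral_itv_obnd_cbnd; last exact: miI.
  rewrite -RintegralZl//.
  by rewrite /kap /Rintegral fineK// integrable_fin_num//; exact: m2iI.
(* Dropping the measure of [M - f] from the sum bounds [nu] by [kap], whence both its finiteness and
   its absolute continuity. *)
have nuH A : measurable A -> (nu A <= kap A)%E.
  move=> mA; rewrite -[leRHS]/(kapM A) -Hkap// HF// measure_addE.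
  by rewrite leeDl.
have nufin : fin_num_fun nu.
  move=> A mA; rewrite ge0_fin_numE ?measure_ge0// (le_lt_trans (nuH _ mA))//.
  rewrite -ge0_fin_numE; last exact: kap_ge0.
  by rewrite /kap integrable_fin_num//; exact: m2iI.
pose nuM : {finite_measure set (measurableTypeR R) -> \bar R} :=
  HB.pack_for {finite_measure set (measurableTypeR R) -> \bar R} nu
    (Measure_isFinite.Build _ _ _ nu nufin).
have dom : nuM `<< leb.
  apply/null_content_dominatesP => A mA A0; apply/eqP.
  rewrite eq_le measure_ge0 andbT (le_trans (nuH _ mA))// /kap.
  rewrite null_set_integral//; apply: measurable_int (m2iI _ mA).
have [q [_ qfin qi qE]] := radon_nikodym_sigma_finite dom.
have fqi : integrableR (fine \o q).
  by apply: eq_integrable qi => // x _ /=; rewrite fineK.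
exists (fun x => fine (q x) - m x).
  have := integrableB measurableT fqi mi; exact.
move=> s t st.
have fqI (I : interval R) : leb.-integrable [set` I] (EFin \o (fine \o q)).
  exact: integrableS fqi.
rewrite RintegralB//.
have <- : F t - F s = \int[leb]_(x in `[s, t]) fine (q x).
  rewrite -Rintegral_itv_obnd_cbnd; last exact: fqI.
  apply: EFin_inj; rewrite -LS_measure_itv// -[LHS]/(nuM [set` `]s, t]]) qE//.
  rewrite /Rintegral fineK; first by apply: eq_integral => x _ /=; rewrite fineK.
  by rewrite integrable_fin_num//; exact: fqI.
by rewrite -ME// !FE; ring.
Unshelve. all: by end_near. Qed.

End absolutely_continuous.

Section metric_derivative.
Context {R : realType}.
Local Notation leb := (@lebesgue_measure R).
Implicit Types (f g m : R -> R) (s t : R).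

Lemma AC_ae_derive f g : integrableR g ->
  (forall s t, s <= t -> f t - f s = \int[leb]_(x in `[s, t]) g x) ->
  {ae leb, forall t, is_derive t 1 f (g t)}.
Proof.
move=> gi fg; set G := fun t => \int[leb]_(x in `]-oo, t]) g x.
have fE : f = G + cst (f 0 - G 0).
  apply/funext => t; rewrite -[RHS]/(G t + (f 0 - G 0)).
  have [t0|/ltW t0] := leP 0 t; have := fg _ _ t0;
    rewrite -Rintegral_itvcc// -/(G t) -/(G 0); lra.
have giI y : leb.-integrable `]-oo, y] (EFin \o g) by exact: integrableS gi.
have := FTC1Ny giI (open_integrable_locally openT gi).
apply: filterS; first exact: (ae_filter_ringOfSetsType leb).
move=> t [dG Gt]; rewrite fE.
rewrite -[g t]addr0; apply: is_deriveD.
by split => //; rewrite -derive1E.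
Qed.

Lemma cvg_norm_derive f t l : is_derive t 1 f l ->
  `|f (t + h) - f t| / `|h| @[h --> (0 : R)^'] --> `|l|.
Proof.
move=> [/cvg_ex[l' fl] fc]; have ll : l' = l.
  by rewrite -fc; apply/esym/cvg_lim => //; exact: Rhausdorff.
subst l'; apply: cvg_trans (cvg_norm fl); apply: near_eq_cvg; near=> h.
by rewrite /= normrM normfV mulrC /GRing.scale/= mulr1 (addrC h).
Unshelve. all: by end_near. Qed.

Context {X : metricType R}.

(* The speed is the supremum of the derivatives of the distances to the points
   of a dense sequence on the curve. *)
Lemma metric_speed_ae (v : R -> X) m : integrableR m -> (forall x, 0 <= m x) ->
  (forall s t, s <= t -> mdist (v s) (v t) <= \int[leb]_(x in `[s, t]) m x) ->
  exists h : R -> R, [/\ integrableR h, (forall x, 0 <= h x),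
    (forall s t, s <= t -> mdist (v s) (v t) <= \int[leb]_(x in `[s, t]) h x) &
    {ae leb, forall t,
      mdist (v (t + k)) (v t) / `|k| @[k --> (0 : R)^'] --> h t}].
Proof.
move=> mi m0 vm.
(* The rational times; a code that decodes to nothing gives time [0], a harmless repetition. *)
pose q (n : nat) : R := ratr (odflt 0 (unpickle n)).
pose d n t := mdist (v t) (v (q n)).
have dm n s t : s <= t -> `|d n t - d n s| <= \int[leb]_(x in `[s, t]) m x.
  by move=> st; rewrite (le_trans (mdist_lipschitz _ _ _))// metric_sym vm.
have /choice[g gP] n : exists g, integrableR g /\
    forall s t, s <= t -> d n t - d n s = \int[leb]_(x in `[s, t]) g x.
  by have [g gi gE] := AC_density mi m0 (dm n); exists g.
(* The cap at [m] makes the supremum finite and integrable; at [good] times it changes nothing,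
   every [|g n t|] being at most [m t] there. *)
pose he (t : measurableTypeR R) : \bar R := mine (esups (fun n =>
  `|g n t|%:E) 0%N) (m t)%:E.
pose h t := fine (he t).
have gm : measurable_fun [set: measurableTypeR R] he.
  apply: measurable_mine; last exact: measurable_int mi.
  apply: measurable_fun_esups => n.
  have := integrable_abse (gP n).1; exact: measurable_int.
have he_ge0 t : (0 <= he t)%E.
  rewrite /he le_min lee_fin m0 andbT.
  apply: (@le_trans _ _ `|g 0%N t|%:E); first by rewrite lee_fin.
  by apply: ereal_sup_ubound; exists 0%N.
have hE t : (h t)%:E = he t.
  rewrite fineK// ge0_fin_numE// (@le_lt_trans _ _ (m t)%:E) ?ltry//.
  by rewrite ge_min lexx orbT.
have h0 t : 0 <= h t by rewrite -lee_fin hE.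
have hm t : h t <= m t by rewrite -lee_fin hE ge_min lexx orbT.
have hi : integrableR h.
  apply: (le_integrable measurableT _ _ mi) => /=.
    by apply: eq_measurable_fun gm => t _ /=; rewrite hE.
  by move=> t _; rewrite lee_fin !ger0_norm.
pose good t := [/\ is_derive t 1 (fun t => \int[leb]_(x in `]-oo, t]) m x) (m t),
  is_derive t 1 (fun t => \int[leb]_(x in `]-oo, t]) h x) (h t) &
  forall n, is_derive t 1 (d n) (g n t)].
have good_ae : {ae leb, forall t, good t}.
  have H1 := AC_ae_derive mi (fun s t => @Rintegral_itvcc _ m s t mi).
  have H2 := AC_ae_derive hi (fun s t => @Rintegral_itvcc _ h s t hi).
  have H3 : {ae leb, forall t, forall n, is_derive t 1 (d n) (g n t)}.
    by apply: ae_foralln => n; apply: AC_ae_derive; [exact: (gP n).1|exact: (gP n).2].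
  have aeF := ae_filter_ringOfSetsType leb.
  have := @filterI _ _ aeF _ _ H1 (@filterI _ _ aeF _ _ H2 H3).
  apply: filterS.
  by move=> t [? [? ?]]; split.
have gle t n : good t -> `|g n t| <= h t.
  move=> [dM _ dg]; rewrite -lee_fin hE le_min; apply/andP; split.
    by apply: ereal_sup_ubound; exists n.
  rewrite lee_fin -(ger0_norm (m0 t)).
  apply: ler_cvg_to (cvg_norm_derive (dg n)) (cvg_norm_derive dM) _.
  near=> k; rewrite ler_wpM2r ?invr_ge0//.
  have [k0|/ltW k0] := leP 0 k.
    rewrite (le_trans (dm n _ _ _)) ?lerDl// -Rintegral_itvcc ?lerDl//.
    exact: ler_norm.
  rewrite distrC (le_trans (dm n _ _ _)) ?gerDl// -Rintegral_itvcc ?gerDl//.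
  by rewrite distrC; exact: ler_norm.
have hle t e : good t -> 0 < e -> exists n, h t - e < `|g n t|.
  move=> gt e0.
  have : ((h t - e)%:E < esups (fun n => `|g n t|%:E) 0%N)%E.
    rewrite (@lt_le_trans _ _ (h t)%:E) ?lte_fin ?gtrBl//.
    by rewrite hE ge_min lexx.
  by move=> /ereal_sup_gt[_ [n _ <-]]; rewrite lte_fin => ?; exists n.
(* If [v (q n)] is within [e / 2] of [v s], then [mdist (v s) (v t)] exceeds the increment of [d n]
   by at most [e], and almost everywhere [|g n| <= h]. *)
have vh s t : s <= t -> mdist (v s) (v t) <= \int[leb]_(x in `[s, t]) h x.
  move=> st; apply/ler_addgt0Pr => e e0.
  have e2 : 0 < e / 2 by rewrite divr_gt0.
  have [n ne] : exists n, mdist (v s) (v (q n)) < e / 2.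
    have /cvgrPdist_lt/(_ _ e2) := @continuous_Rintegral _ _ mi s.
    move=> /nbhs_ballP[r /= r0 rP].
    have : s < s + r by rewrite ltrDl.
    move=> /rat_in_itvoo[z]; rewrite in_itv/= => /andP[sz zr].
    exists (pickle z); rewrite /q pickleK/=.
    rewrite (le_lt_trans (vm _ _ (ltW sz)))// -Rintegral_itvcc ?(ltW sz)//.
    have := rP (ratr z); rewrite /ball/= distrC gtr0_norm ?subr_gt0// ltrBlDl =>
      /(_ zr).
    by rewrite distrC => /ltr_normlW.
  have gi := (gP n).1.
  have gd : `|d n t - d n s| <= \int[leb]_(x in `[s, t]) h x.
    rewrite (gP n).2//.
    have gI : leb.-integrable `[s, t] (EFin \o g n) by exact: integrableS gi.
    rewrite (le_trans (le_normr_Rintegral _ gI))//.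
    have hI : leb.-integrable `[s, t] (EFin \o h) by exact: integrableS hi.
    have gaI : leb.-integrable `[s, t] (EFin \o (fun x => `|g n x|)).
      exact: (integrable_abse gI).
    rewrite /Rintegral fine_le ?integrable_fin_num//.
    apply: ae_ge0_le_integral => //.
    - exact: measurable_int gaI.
    - by move=> x _; rewrite lee_fin.
    - exact: measurable_int hI.
    apply: filterS good_ae; first exact: (ae_filter_ringOfSetsType leb).
    by move=> x gx _; rewrite lee_fin gle.
  have : mdist (v s) (v t) <= mdist (v s) (v (q n)) + d n t.
    by rewrite /d (metric_sym (v t)); exact: metric_triangle.
  have : d n t - d n s <= `|d n t - d n s| by exact: ler_norm.
  move: gd ne; rewrite /d; lra.
exists h; split => //.
apply: filterS good_ae; first exact: (ae_filter_ringOfSetsType leb).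
move=> t gt.
have [dM dh dg] := gt.
set H := fun t => _ in dh.
apply/cvgrPdist_lt => e e0.
(* The difference quotient of [v] is squeezed between those of [d n] and of the primitive [H] of
   [h]. *)
have [n nP] := hle t _ gt (divr_gt0 e0 (ltr0n _ 2)).
have e2 : 0 < e / 2 by rewrite divr_gt0.
have /cvgrPdist_lt/(_ _ e2) H1 := cvg_norm_derive (dg n).
have /cvgrPdist_lt/(_ _ e2) H2 := cvg_norm_derive dh.
near=> k.
have : `| `|g n t| - `|d n (t + k) - d n t| / `|k| | < e / 2 by near: k.
have : `| `|h t| - `|H (t + k) - H t| / `|k| | < e / 2 by near: k.
have ki : 0 <= `|k|^-1 by rewrite invr_ge0.
have : `|d n (t + k) - d n t| / `|k| <= mdist (v (t + k)) (v t) / `|k|.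
  by rewrite ler_wpM2r// mdist_lipschitz.
have : mdist (v (t + k)) (v t) / `|k| <= `|H (t + k) - H t| / `|k|.
  rewrite ler_wpM2r//; have [k0|/ltW k0] := leP 0 k.
    rewrite metric_sym (le_trans (vh _ _ _)) ?lerDl// -Rintegral_itvcc ?lerDl//.
    exact: ler_norm.
  rewrite distrC (le_trans (vh _ _ _)) ?gerDl// -Rintegral_itvcc ?gerDl//.
  exact: ler_norm.
rewrite (ger0_norm (h0 t)) !ltr_norml => H3 H4 /andP[H5 H6] /andP[H7 H8].
by apply/andP; split; lra.
Unshelve. all: by end_near. Qed.

End metric_derivative.

(* The metric derivative and the slope need not be measurable along the curve;
   the integral of a nonnegative function is a lower integral. *)
Lemma ge0_le_integral_nonmeasurable d (T : measurableType d) (R : realType)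
    (mu : {measure set T -> \bar R}) (f g : T -> \bar R) :
  (forall x, 0 <= f x)%E -> (forall x, f x <= g x)%E ->
  (\int[mu]_x f x <= \int[mu]_x g x)%E.
Proof.
move=> f0 fg; rewrite !ge0_integralTE//; last by move=> x; exact: le_trans (fg x).
apply: le_ereal_sup => _ [h hf <-]; exists h => // x.
exact: le_trans (fg x).
Qed.

(** Measurability of the smaller function allows the exceptional null set to be removed from its
    domain; outside that set the comparison is pointwise. *)
Lemma ae_ge0_le_integral_nonmeasurable d (T : measurableType d) (R : realType)
    (mu : {measure set T -> \bar R}) (D E : set T) (f g : T -> \bar R) :
  measurable D -> D `<=` E -> measurable_fun D f ->
  (forall x, 0 <= f x)%E -> (forall x, 0 <= g x)%E ->
  {ae mu, forall x, D x -> (f x <= g x)%E} ->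
  (\int[mu]_(x in D) f x <= \int[mu]_(x in E) g x)%E.
Proof.
move=> mD DE mf f0 g0 [N [mN N0 fgN]].
rewrite (ge0_negligible_integral mN mD mf (fun x _ => f0 x) N0).
rewrite integral_mkcond [leRHS]integral_mkcond;
  apply: ge0_le_integral_nonmeasurable => x.
  by rewrite erestrict_ge0.
rewrite !patchE; case: ifPn => [|_]; last by case: ifPn.
rewrite inE => -[Dx Nx]; rewrite mem_set//; last exact: DE.
apply: contrapT => H; apply: Nx; apply: fgN => /= H'; apply: H; exact: H'.
Qed.

(** * Lebesgue integrals on the line, Riemann sums and speed of curves *)

Section lebesgue.
Context {R : realType}.
Local Notation leb := (@lebesgue_measure R).
Implicit Types (a b c h s t : R) (f : R -> \bar R).

(** Lebesgue measure is its own image under a translation, as both agree on half-open intervals. *)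
Lemma integral_translation f a b c : measurable_fun [set: measurableTypeR R] f ->
  (forall x, 0 <= f x)%E ->
  (\int[leb]_(x in `]a, b]) f (x + c)%R = \int[leb]_(x in `](a + c)%R, (b + c)%R]) f
    x)%E.
Proof.
move=> mf f0; pose s (x : measurableTypeR R) : measurableTypeR R := (x : R) + c.
have ms : measurable_fun [set: measurableTypeR R] s.
  exact: measurable_funD.
pose P0 : {measure set (measurableTypeR R) -> \bar R} := pushforward leb s.
pose P := P0 ms.
have E A : measurable A -> leb A = P A.
  apply: lebesgue_measure_unique => _ [[u w] _ <-].
  rewrite /= /pushforward.
  have -> : s @^-1` `]u, w] = `](u - c), (w - c)]%classic.
    by apply/seteqP; split => x /=; rewrite !in_itv/= /s ltrBlDr lerBrDr.
  rewrite !lebesgue_measure_itv/= !lte_fin ltrD2r; case: ifP => // _.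
  by rewrite -!EFinB; congr EFin; ring.
transitivity (\int[P]_(x in `](a + c)%R, (b + c)%R]) f x)%E.
  rewrite /P /P0 (ge0_integral_pushforward ms)//; last exact: measurable_funTS.
  congr (integral _ _ _); apply/seteqP.
  by split => x; rewrite /= !in_itv/= /s ltrD2r lerD2r.
by apply: eq_measure_integral => A mA _; apply/esym; exact: E.
Qed.

Lemma integral_oc_setU f a b c : measurable_fun [set: measurableTypeR R] f ->
  (forall x, 0 <= f x)%E -> a <= b -> b <= c ->
  (\int[leb]_(x in `]a, c]) f x =
   \int[leb]_(x in `]a, b]) f x + \int[leb]_(x in `]b, c]) f x)%E.
Proof.
move=> mf f0 ab bc.
rewrite -ge0_integral_setU//; last 2 first.
- exact: measurable_funTS.
- by apply/lt_disjoint => x y; rewrite !in_itv/= => /andP[_ xb] /andP[by_ _];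
    exact: le_lt_trans by_.
congr (integral _ _ _); apply/seteqP; split => x /=; rewrite !in_itv/=.
  by case: (leP x b) => xb /andP[ax xc]; [left; rewrite ax|right].
by case=> /andP[H1 H2]; apply/andP; split => //; lra.
Qed.

Lemma integral_oc_sum f a h n : measurable_fun [set: measurableTypeR R] f ->
  (forall x, 0 <= f x)%E -> 0 <= h ->
  (\sum_(k < n) \int[leb]_(x in `](a + k%:R * h)%R, (a + k.+1%:R * h)%R]) f x =
   \int[leb]_(x in `]a, (a + n%:R * h)%R]) f x)%E.
Proof.
move=> mf f0 h0; elim: n => [|n IH].
  by rewrite big_ord0 mul0r addr0 set_itv_ge ?integral_set0// bnd_simp ltxx.
rewrite big_ord_recr/= IH -integral_oc_setU//.
  by rewrite lerDl mulr_ge0.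
by rewrite lerD2l ler_wpM2r// ler_nat.
Qed.

(* Averaging over the offset [s] turns the Riemann sums of [f] into its
   integral, so some offset does not exceed the average. *)
Lemma exists_riemann_sum_le f h n I e : measurable_fun [set: measurableTypeR R] f ->
  (forall x, 0 <= f x)%E -> 0 < h -> 0 < e ->
  (\int[leb]_(x in `]0%R, (n%:R * h)%R]) f x <= I%:E)%E ->
  exists2 s, 0 < s <= h & (h%:E * \sum_(k < n) f (s + k%:R * h)%R <= (I + e)%:E)%E.
Proof.
move=> mf f0 h0 e0 fI; apply: contrapT => H.
pose F x := (\sum_(k < n) f (x + k%:R * h)%R)%E.
have mfk (k : nat) : measurable_fun [set: measurableTypeR R]
    ((fun x => f (x + k%:R * h)%R) : measurableTypeR R -> \bar R).
  apply: (measurableT_comp mf); exact: measurable_funD.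
have mF : measurable_fun [set: measurableTypeR R] (F : measurableTypeR R -> \bar R).
  by apply: emeasurable_sum => k _; exact: mfk.
have FI : (\int[leb]_(x in `]0%R, h]) F x <= I%:E)%E.
  apply: le_trans fI; rewrite ge0_integral_sum//; last first.
    by move=> k; apply: measurable_funTS; exact: mfk.
  have := @integral_oc_sum f 0 h n mf f0 (ltW h0); rewrite add0r => <-.
  apply: lee_sum => k _; rewrite integral_translation//.
  by rewrite [in leRHS]mulrSr mulrDl mul1r !add0r (addrC _ h).
have : (\int[leb]_(x in `]0%R, h]) (cst ((I + e) / h)%:E) x <= \int[leb]_(x in
  `]0%R, h]) F x)%E.
  have I0 : 0 <= I.
    by rewrite -lee_fin (le_trans _ fI)//; exact: integral_ge0.
  apply: ge0_le_integral => //.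
  - by move=> x _; rewrite lee_fin divr_ge0 ?(ltW h0)// addr_ge0// ltW.
  - exact: measurable_funTS.
  move=> x; rewrite /= in_itv/= => xh; rewrite leNgt; apply/negP => Fx.
  apply: H; exists x => //; rewrite -/(F x).
  have -> : I + e = h * ((I + e) / h) by rewrite mulrC divfK// gt_eqF.
  by rewrite EFinM lee_pmul2l ?ltW.
rewrite integral_cst//= lebesgue_measure_itv/= lte_fin h0 sube0 -EFinM divfK
  ?gt_eqF//.
by move=> /le_trans => /(_ _ FI); rewrite lee_fin; lra.
Qed.

(* AM-GM in place of Cauchy-Schwarz: [2 c h <= c^2 + h^2] with [c = d / (t - s)]. *)
Lemma sqr_Rintegral_le (g : R -> R) s t d : integrableR g ->
  (forall x, 0 <= g x) -> s < t -> 0 <= d -> d <= \int[leb]_(x in `[s, t]) g x ->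
  ((d ^+ 2 / (t - s))%:E <= \int[leb]_(x in `]s, t]) (g x ^+ 2)%:E)%E.
Proof.
move=> gi g0 st d0 dg; have ts : 0 < t - s by rewrite subr_gt0.
set c := d / (t - s).
have c0 : 0 <= c by rewrite divr_ge0// ltW.
have gI : leb.-integrable `]s, t] (EFin \o g) by exact: integrableS gi.
have mg : measurable_fun `]s, t] g by apply/measurable_EFinP;
  exact: measurable_int gI.
have mg2 : measurable_fun `]s, t] (fun x => (g x ^+ 2)%:E).
  by apply/measurable_EFinP; exact: measurable_funX.
have : (\int[leb]_(x in `]s, t]) (2 * c * g x)%:E <=
         \int[leb]_(x in `]s, t]) ((c ^+ 2)%:E + (g x ^+ 2)%:E))%E.
  apply: ge0_le_integral => //.
  - by move=> x _; rewrite lee_fin; apply: mulr_ge0 => //; exact: mulr_ge0.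
  - by apply/measurable_EFinP; exact: measurable_funM.
  - exact: emeasurable_funD.
  - by move=> x _; rewrite lee_fin; have := sqr_ge0 (c - g x); nra.
rewrite ge0_integralD//; last 2 first.
- by move=> x _; rewrite lee_fin sqr_ge0.
- by move=> x _; rewrite lee_fin sqr_ge0.
rewrite integral_cst//= lebesgue_measure_itv/= lte_fin st -EFinB -EFinM.
have -> : (\int[leb]_(x in `]s, t]) (2 * c * g x)%:E =
    (2 * c * \int[leb]_(x in `[s, t]) g x)%:E)%E.
  rewrite -Rintegral_itv_obnd_cbnd// -RintegralZl// /Rintegral fineK//.
  apply: integrable_fin_num => //.
  have mI : measurable (`]s, t]%classic : set (measurableTypeR R)) by [].
  by have := integrableZl mI (2 * c) gI; exact.
have -> : d ^+ 2 / (t - s) = 2 * c * d - c ^+ 2 * (t - s).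
  by rewrite /c; field; rewrite gt_eqF.
move=> H; rewrite EFinB leeBlDl//; apply: le_trans H.
by rewrite lee_fin ler_wpM2l// mulr_ge0.
Qed.

(** [metric_speed_ae] wants a curve on the whole line with an integrable control: [c] clamps time
    between [0] and [T], and [|m|] is cut off outside, integrable because [|m| <= 1 + m ^+ 2]. Near
    each time of []0, T[] the clamp is the identity, so the metric derivative is unchanged. *)
Lemma AC2_loc_speed {X : metricType R} (v : R -> X) T : AC2_loc v -> 0 < T ->
  exists g : R -> R, [/\ integrableR g, (forall x, 0 <= g x),
    (forall s t, 0 <= s -> s <= t -> t <= T ->
      mdist (v s) (v t) <= \int[leb]_(x in `[s, t]) g x) &
    {ae leb, forall t, 0 < t < T -> metric_derivative v t = g t}].
Proof.
move=> [m [[mm m2] vm]] T0.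
pose c t := Num.min T (Num.max 0 t).
pose w t := v (c t).
pose M := (fun x => `|m x|) \_ `[0, T].
have mT : leb.-integrable `[0, T] (EFin \o m).
  have mmT : measurable_fun `[0, T] m.
    by apply: measurable_funS mm => //; exact: subset_itvl.
  have i2 : leb.-integrable `[0, T] (fun x => (1 + m x ^+ 2)%:E).
    have i1 : leb.-integrable `[0, T] (cst 1%:E).
      apply/integrableP; split; first exact: measurable_cst.
      by under eq_integral do rewrite /= normr1;
        rewrite integral_cst//= lebesgue_measure_itv/= lte_fin T0 mul1e ltry.
    have i3 : leb.-integrable `[0, T] (fun x => (m x ^+ 2)%:E).
      apply/integrableP; split.
        by apply/measurable_EFinP; exact: measurable_funX.
      by under eq_integral do rewrite /= ger0_norm ?sqr_ge0//; exact: m2.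
    have mI : measurable (`[0, T]%classic : set (measurableTypeR R)) by [].
    by have := integrableD mI i1 i3; exact.
  apply: (le_integrable _ _ _ i2) => //; first exact/measurable_EFinP.
  move=> x _; rewrite lee_fin [leRHS]ger0_norm ?addr_ge0 ?sqr_ge0//.
  have := sqr_ge0 (`|m x| - 1); have := normr_ge0 (m x).
  rewrite -[m x ^+ 2]real_normK ?num_real//; nra.
have Mi : integrableR M.
  rewrite /integrableR /M -restrict_EFin; apply/(integrable_mkcond _ _).1 => //.
  exact: (integrable_abse mT).
have M0 x : 0 <= M x by rewrite /M patchE; case: ifPn.
have cE t : 0 <= t -> t <= T -> c t = t.
  by move=> t0 tT; rewrite /c max_r// min_r.
have wM s t : s <= t -> mdist (w s) (w t) <= \int[leb]_(x in `[s, t]) M x.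
  move=> st; have MI (I : interval R) : leb.-integrable [set` I] (EFin \o M).
    exact: integrableS Mi.
  have [ct|] := leP (c t) (c s).
    have -> : w s = w t.
      congr v; apply/eqP; rewrite eq_le ct andbT.
      rewrite /c le_min !ge_min lexx /=; apply/orP; right.
      by rewrite ge_max !le_max lexx st orbT.
    by rewrite mdistxx Rintegral_ge0.
  move=> sct.
  have cT u : 0 <= c u <= T.
    by rewrite /c le_min ge_min lexx le_max lexx !andbT ltW.
  have sc : s <= c s.
    have : c s < T by rewrite (lt_le_trans sct)//; case/andP: (cT t).
    by rewrite /c gt_min ltxx/= => cs; rewrite min_r ?(ltW cs)// le_max lexx orbT.
  have tc : c t <= t.
    have : 0 < c t by rewrite (le_lt_trans _ sct)//; case/andP: (cT s).
    by rewrite /c lt_min => /andP[_]; rewrite lt_max ltxx/= => t0;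
      rewrite max_r ?(ltW t0)// ge_min lexx orbT.
  have cI : `[c s, c t] `<=` `[0, T].
    move=> x; rewrite /= !in_itv/= => /andP[sx xt].
    have /andP[s0 _] := cT s; have /andP[_ tT] := cT t.
    by rewrite (le_trans s0)//= (le_trans xt).
  have mI : leb.-integrable `[c s, c t] (EFin \o m) by exact: integrableS mT.
  have cs0 : 0 <= c s by case/andP: (cT s).
  rewrite -lee_fin; apply: (le_trans (vm _ _ cs0 (ltW sct))).
  rewrite /Rintegral fineK; last by apply: integrable_fin_num.
  apply: (@le_trans _ _ (\int[leb]_(x in `[c s, c t]) (M x)%:E)%E); last first.
    apply: ge0_subset_integral => //.
    - exact: measurable_int (MI _).
    - by move=> x _; rewrite lee_fin.
    - move=> x; rewrite /= !in_itv/= => /andP[sx xt].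
      by rewrite (le_trans sc)//= (le_trans xt).
  apply: le_integral => //.
  move=> x; rewrite inE => xI; rewrite /M patchE mem_set; last exact: cI.
  by rewrite lee_fin ler_norm.
have [g [gi g0 wg gd]] := metric_speed_ae Mi M0 wM.
exists g; split => //.
  by move=> s t s0 st tT; have := wg _ _ st;
    rewrite /w !cE// ?(le_trans st)// (le_trans s0).
apply: filterS gd; first exact: (ae_filter_ringOfSetsType leb).
move=> t gt /andP[t0 tT]; apply/cvg_lim; first exact: Rhausdorff.
apply: cvg_trans gt; apply: near_eq_cvg; near=> k.
have tk : 0 <= t + k <= T.
  suff : `|k| <= Num.min t (T - t) by rewrite le_min !ler_norml; lra.
  by near: k; apply: dnbhs0_le; rewrite lt_min t0 subr_gt0.
by rewrite /w (cE t) ?(ltW t0) ?(ltW tT)// (cE (t + k))//; case/andP: tk.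
Unshelve. all: by end_near. Qed.

End lebesgue.

(** * Curves satisfying the energy-dissipation inequality *)

Lemma AC2_loc_continuous {R : realType} {X : metricType R} (v : R -> X) :
  AC2_loc v -> continuous (fun t : R => v (Num.max 0 t)).
Proof.
move=> vAC t; set t' := Num.max 0 t.
have t'0 : 0 <= t' by rewrite le_max lexx.
have T0 : 0 < t' + 1 by rewrite ltr_wpDl.
have [g [gi g0 vg _]] := AC2_loc_speed vAC T0.
apply/cvg_mdist => e e0.
have /cvgrPdist_lt/(_ _ e0) := @continuous_Rintegral _ _ gi t'.
move=> /nbhs_ballP[r /= r0 rP].
have r1 : 0 < Num.min r 1 by rewrite lt_min r0 ltr01.
near=> s; set s' := Num.max 0 s.
have s'0 : 0 <= s' by rewrite le_max lexx.
have ts : `|t - s| < Num.min r 1.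
  by near: s; exact: (@nbhsx_ballx _ R^o t _ r1).
have ts' : `|t' - s'| <= `|t - s|.
  rewrite /t' /s'; case: (leP 0 t) => ?; case: (leP 0 s) => ?;
    rewrite ?subrr ?normr0 ?normr_ge0 ?lexx//.
  - by rewrite subr0 ger0_norm// ger0_norm; lra.
  - by rewrite sub0r normrN ger0_norm// ler0_norm; lra.
have tsr : `|t' - s'| < r by rewrite (le_lt_trans ts')// (lt_le_trans ts)// ge_min
  lexx.
have ts1 : `|t' - s'| < 1.
  by rewrite (le_lt_trans ts')// (lt_le_trans ts)// ge_min lexx orbT.
have sT : s' <= t' + 1 by move: ts1; rewrite ltr_norml; lra.
have M := rP s' tsr; have [st|/ltW st] := leP s' t'.
  rewrite (le_lt_trans (vg _ _ s'0 st _))// ?lerDl// -Rintegral_itvcc//.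
  exact: ltr_normlW.
rewrite metric_sym (le_lt_trans (vg _ _ t'0 st sT))// -Rintegral_itvcc//.
by move: M; rewrite distrC => /ltr_normlW.
Unshelve. all: by end_near. Qed.

Section energy_dissipation.
Context {R : realType} {X : metricType R} {phi : X -> \bar R} {lambda : R}
  {D : set X} {S : R -> X -> X} {v : R -> X}.
Context (phi_proper : proper_functional phi)
  (phi_lsc : lower_semicontinuous phi)
  (v_AC : AC2_loc v)
  (v_EDI : energy_dissipation_inequality phi v)
  (v_D : forall t : R, 0 <= t -> D (v t))
  (S_flow : EVI_gradient_flow lambda phi D S).

Local Notation p x := (fine (phi x)).
Local Notation leb := (@lebesgue_measure R).
Local Notation gs := (@global_slope _ _ phi lambda).

Let EDI_integrand_ge0 r :
  (0 <= (2^-1 * metric_derivative v r ^+ 2)%:E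
         + (2^-1)%:E * metric_slope phi (v r) ^+ 2)%E.
Proof.
apply: adde_ge0; first by rewrite lee_fin mulr_ge0// sqr_ge0.
by apply: mule_ge0 => //; apply: expe_ge0; exact: metric_slope_ge0.
Qed.

(** An infinite [phi (v t)] would make the left side of the inequality infinite, its integral being
    nonnegative. *)
Lemma EDI_Dom t : 0 <= t -> Dom phi (v t).
Proof.
rewrite le_eqVlt => /predU1P[<-|t0]; first exact: v_EDI.1.
rewrite /Dom/= ltey; apply/eqP => vt; have := v_EDI.2 _ t0.
rewrite vt addey; first by rewrite leye_eq => /eqP v0; have := v_EDI.1;
  rewrite /Dom/= v0.
rewrite gt_eqF// (@lt_le_trans _ _ 0%E)//; apply: integral_ge0 => r _.
exact: EDI_integrand_ge0.
Qed.

Lemma measurable_slope : measurable_fun [set: measurableTypeR R]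
  ((fun r : R => gs (v (Num.max 0%R r)) ^+ 2)%E : measurableTypeR R -> \bar R).
Proof.
have m : measurable_fun [set: measurableTypeR R]
    ((fun r : R => gs (v (Num.max 0%R r))) : measurableTypeR R -> \bar R).
  apply: lower_semicontinuous_measurable; apply: lsc_global_slope => //.
    exact: AC2_loc_continuous.
  by move=> r; apply: EDI_Dom; rewrite le_max lexx.
by apply: emeasurable_funM.
Qed.

(** Twice the energy-dissipation inequality, with measurable minorants in the integrand: [g] is the
    metric derivative almost everywhere and the global slope is below the metric slope. Only then
    can the integral be split in two. *)
Lemma EDI_speed_slope T t (g : R -> R) : integrableR g -> (forall x, 0 <= g x) ->
  {ae leb, forall r, 0 < r < T -> metric_derivative v r = g r} ->
  0 < t -> t < T ->
  (\int[leb]_(r in `]0%R, t]) (g r ^+ 2)%:E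
   + \int[leb]_(r in `]0%R, t]) (gs (v (Num.max 0%R r)) ^+ 2)
   <= (2 * (p (v 0) - p (v t)))%:E)%E.
Proof.
move=> gi g0 gd t0 tT.
have mgs := measurable_slope.
have mg2 : measurable_fun [set: measurableTypeR R] (fun r : measurableTypeR R =>
  (g r ^+ 2)%:E).
  apply/measurable_EFinP/measurable_funX/measurable_EFinP.
  exact: measurable_int gi.
have gs0 r : (0 <= gs (v (Num.max 0%R r)) ^+ 2)%E by apply: expe_ge0;
  exact: global_slope_ge0.
have g20 r : (0 <= (g r ^+ 2)%:E)%E by rewrite lee_fin sqr_ge0.
rewrite -ge0_integralD//; [|exact: measurable_funTS|exact: measurable_funTS].
have mf : measurable_fun [set: measurableTypeR R]
    (fun r : measurableTypeR R => (g r ^+ 2)%:E + gs (v (Num.max 0%R r)) ^+ 2)%E.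
  exact: emeasurable_funD.
have f0 r : (0 <= (g r ^+ 2)%:E + gs (v (Num.max 0%R r)) ^+ 2)%E by exact: adde_ge0.
have := v_EDI.2 _ t0.
rewrite -(fine_phiE phi_proper (EDI_Dom (ltW t0))) -(fine_phiE phi_proper v_EDI.1).
rewrite -leeBrDr// -EFinB => edi.
rewrite -(@lee_pmul2l _ (2^-1)%:E)//.
rewrite -[leRHS]EFinM mulrA mulVf// mul1r; apply: le_trans edi.
rewrite -ge0_integralZl//; last exact: measurable_funTS.
apply: ae_ge0_le_integral_nonmeasurable => //.
- by move=> r; rewrite /= !in_itv/= => /andP[/ltW -> ->].
- by apply: measurable_funeM; exact: measurable_funTS.
- by move=> r; exact: mule_ge0.
apply: filterS gd; first exact: (ae_filter_ringOfSetsType leb).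
move=> r gr; rewrite /= in_itv/= => /andP[r0 rt].
rewrite gr ?r0 ?(le_lt_trans rt)// ge0_muleDr ?gs0 ?g20//.
apply: leeD; first by rewrite -EFinM.
rewrite lee_pmul2l// ?lte_fin ?invr_gt0//.
rewrite max_r ?(ltW r0)//.
have H : (gs (v r) <= metric_slope phi (v r))%E.
  by apply: (global_slope_le phi_proper S_flow);
    [exact: v_D (ltW r0)|exact: EDI_Dom (ltW r0)].
by apply: lee_pmul => //; exact: global_slope_ge0.
Qed.

End energy_dissipation.

(** * Discretisation of a curve satisfying the energy-dissipation inequality *)

Section energy_dissipation_partition.
Context {R : realType} {X : metricType R} {phi : X -> \bar R} {lambda : R}
  {D : set X} {S : R -> X -> X} {v : R -> X}.
Context (phi_proper : proper_functional phi)
  (phi_lsc : lower_semicontinuous phi)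
  (v_AC : AC2_loc v)
  (v_EDI : energy_dissipation_inequality phi v)
  (v_D : forall t : R, 0 <= t -> D (v t))
  (S_flow : EVI_gradient_flow lambda phi D S).

Local Notation p x := (fine (phi x)).
Local Notation leb := (@lebesgue_measure R).
Local Notation gs := (@global_slope _ _ phi lambda).
Local Notation mu := (`|lambda| + 1).
Local Notation expint := (@expint _ lambda).
Local Notation mu_gt0 := (@mu_gt0 _ lambda).
Local Notation slope_bound := (@slope_bound _ _ phi lambda).

Lemma EDI_phi_le t : 0 <= t -> p (v t) <= p (v 0).
Proof.
rewrite le_eqVlt => /predU1P[<-//|t0].
have [g [gi g0 _ gd]] := AC2_loc_speed v_AC (ltr_pwDr ltr01 (ltW t0)).
have := EDI_speed_slope phi_proper phi_lsc v_AC v_EDI v_D S_flow gi g0 gd t0.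
rewrite ltrDl ltr01 => /(_ isT) H.
have : (0 <= (2 * (p (v 0) - p (v t)))%:E)%E.
  apply: le_trans H; apply: adde_ge0; apply: integral_ge0 => r _.
    by rewrite lee_fin sqr_ge0.
  by apply: expe_ge0; exact: global_slope_ge0.
by rewrite lee_fin; lra.
Qed.

(** [A] is the integral of the squared speed up to [T + s] and [B] that of the squared slope up to
    [T], so the inequality at time [T + s] pays for both. [e] is the excess allowed to the Riemann
    sum of the slopes, [c] the weight in Young's inequality. *)
Lemma EDI_partition T h n e : 0 < h -> 0 < e -> n%:R * h = T -> 0 < T ->
  exists s A B, [/\ 0 < s <= h, 0 <= A, 0 <= B,
    A + B <= 2 * (p (v 0) - p (v (T + s))) &
    forall c, 0 < c ->
    expR (- (mu * T)) * mdist (S T (v s)) (v (T + s)) <=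
    ((A + 2 * (expint h / h) * (p (v (T + s)) - p (v s))
        + (1 + mu * h * expR (mu * h)) * (B + e)) / c + T * c) / 2].
Proof.
move=> h0 e0 nT T0.
(* As the offset is at most [h], the curve is followed up to at most [T + h]; the 1 gives the strict
   inequality that [EDI_speed_slope] asks for. *)
have T2 : 0 < T + h + 1 by lra.
have [g [gi g0 vg gd]] := AC2_loc_speed v_AC T2.
have edi t : 0 < t -> t < T + h + 1 -> _ :=
  EDI_speed_slope phi_proper phi_lsc v_AC v_EDI v_D S_flow gi g0 gd.
pose f (r : R) : \bar R := (gs (v (Num.max 0%R r)) ^+ 2)%E.
have mf : measurable_fun [set: measurableTypeR R] (f : measurableTypeR R -> \bar R).
  exact: (measurable_slope (lambda := lambda) phi_proper phi_lsc v_AC v_EDI).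
have f0 r : (0 <= f r)%E by apply: expe_ge0; exact: global_slope_ge0.
have mg2 : measurable_fun [set: measurableTypeR R] (fun r : measurableTypeR R =>
  (g r ^+ 2)%:E).
  apply/measurable_EFinP/measurable_funX/measurable_EFinP.
  exact: measurable_int gi.
have g20 r : (0 <= (g r ^+ 2)%:E)%E by rewrite lee_fin sqr_ge0.
have If0 t : (0 <= \int[leb]_(r in `]0%R, t]) f r)%E by exact: integral_ge0.
have Ig0 t : (0 <= \int[leb]_(r in `]0%R, t]) (g r ^+ 2)%:E)%E by exact: integral_ge0.
have Iffin t : 0 < t -> t < T + h + 1 -> (\int[leb]_(r in `]0%R, t]) f r \is a
  fin_num)%E.
  move=> t0 tT; rewrite ge0_fin_numE//.
  by apply: le_lt_trans (le_trans _ (edi t t0 tT)) (ltry _); exact: leeDr.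
have Igfin t : 0 < t -> t < T + h + 1 ->
    (\int[leb]_(r in `]0%R, t]) (g r ^+ 2)%:E \is a fin_num)%E.
  move=> t0 tT; rewrite ge0_fin_numE//.
  by apply: le_lt_trans (le_trans _ (edi t t0 tT)) (ltry _); exact: leeDl.
pose B := fine (\int[leb]_(r in `]0%R, T]) f r)%E.
have BE : (\int[leb]_(r in `]0%R, (n%:R * h)%R]) f r <= B%:E)%E.
  by rewrite nT /B fineK//; apply: Iffin => //; lra.
have [s /andP[s0 sh] sB] := exists_riemann_sum_le mf f0 h0 e0 BE.
pose A := fine (\int[leb]_(r in `]0%R, (T + s)%R]) (g r ^+ 2)%:E)%E.
have Ts0 : 0 < T + s by lra.
have TsT : T + s < T + h + 1 by lra.
exists s, A, B; split; [by rewrite s0|exact: fine_ge0|exact: fine_ge0| |].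
  rewrite -lee_fin EFinD; apply: le_trans (edi _ Ts0 TsT).
  apply: leeD; first by rewrite fineK// Igfin.
  rewrite /B fineK; last by apply: Iffin => //; lra.
  apply: ge0_subset_integral => //.
    exact: measurable_funTS.
  by move=> r; rewrite /= !in_itv/= => /andP[-> rT]/=; lra.
move=> c c0.
pose x (k : nat) := v (s + k%:R * h).
have sk0 (k : nat) : 0 <= s + k%:R * h by rewrite addr_ge0 ?(ltW s0)// mulr_ge0// ltW.
have h0' := ltW h0.
pose K (k : nat) := fine (gs (x k)).
have xE (k : nat) : f (s + k%:R * h) = (gs (x k) ^+ 2)%E.
  by rewrite /f max_r.
(* An infinite slope at a sample point would make the Riemann sum infinite. *)
have Kfin (k : nat) : (k < n)%N -> gs (x k) = (K k)%:E.
  move=> kn; rewrite /K fineK// ge0_fin_numE ?global_slope_ge0//.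
  rewrite ltey; apply/eqP => gx; move: sB.
  rewrite (bigD1 (Ordinal kn))//= xE gx expe2 mulyy addye; last first.
    by rewrite gt_eqF// (@lt_le_trans _ _ 0%E)//; apply: sume_ge0.
  by rewrite gt0_muley ?lte_fin// leye_eq.
have := flow_discrete phi_proper phi_lsc S_flow (n := n) (h := h) (x := x) (K := K)
  (A := A) (B := B + e) h0 c0.
have x0 : x 0%N = v s by rewrite /x mul0r addr0.
have xn : x n = v (T + s) by rewrite /x nT addrC.
rewrite x0 xn nT; apply.
- by move=> k; exact: v_D.
- by move=> k; apply: (EDI_Dom v_EDI).
- by move=> k kn; apply: global_slope_bound; exact: Kfin.
- have hI : (\sum_(k < n) (mdist (x k) (x k.+1) ^+ 2 / h)%:E <=
      \int[leb]_(r in `]s, (s + n%:R * h)%R]) (g r ^+ 2)%:E)%E.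
    rewrite -integral_oc_sum//; apply: lee_sum => k _.
    have khE : s + k.+1%:R * h = s + k%:R * h + h by rewrite mulrSr mulrDl mul1r
      addrA.
    rewrite [X in (_ / X)%:E](_ : h = s + k.+1%:R * h - (s + k%:R * h)); last first.
      by rewrite khE addrAC subrr add0r.
    apply: sqr_Rintegral_le => //.
    + by rewrite khE ltrDl.
    + exact: mdist_ge0.
    + apply: vg => //; first by rewrite khE lerDl.
      rewrite (@le_trans _ _ (T + s)) ?(ltW TsT)// addrC lerD2r -nT.
      by rewrite ler_wpM2r// ler_nat.
  rewrite -lee_fin -sumEFin (le_trans hI)// /A fineK ?Igfin//.
  rewrite nT addrC; apply: ge0_subset_integral => //.
    exact: measurable_funTS.
  by move=> r; rewrite /= !in_itv/= => /andP[sr ->]; rewrite (lt_trans s0).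
- rewrite -lee_fin; apply: le_trans sB.
  rewrite EFinM lee_pmul2l// -sumEFin; apply: lee_sum => k _.
  by rewrite xE Kfin.
Qed.

End energy_dissipation_partition.

(** * Identification of the curve with the flow *)

Theorem theorem4p2 (R : realType) (X : metricType R) (phi : X -> \bar R)
  (v : R -> X) (lambda : R) (D : set X) (S : R -> X -> X)
  (phi_proper : proper_functional phi)
  (phi_lsc : lower_semicontinuous phi)
  (v_AC : AC2_loc v)
  (v_EDI : energy_dissipation_inequality phi v)
  (D_sub : D `<=` closure (Dom phi))
  (v_D : forall t : R, 0 <= t -> D (v t))
  (S_flow : EVI_gradient_flow lambda phi D S) :
  forall t : R, 0 <= t -> v t = S t (v 0).
Proof.
move=> T; rewrite le_eqVlt => /predU1P[<-|T0].
  by rewrite (flow_id S_flow)//; exact: v_D.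
pose p x := fine (phi x).
pose mu := `|lambda| + 1; have mu0 : 0 < mu by exact: mu_gt0.
pose E := expR (mu * T); have E0 : 0 < E := expR_gt0 _.
(* The 1 is for going from [v T] to [v (T + s)], the middle term for the partition estimate, the
   last [E] for the contraction between [v s] and [v 0]. *)
pose c := 1 + E * (5 + T) / 2 + E.
have c0 : 0 < c by rewrite addr_gt0// addr_gt0// divr_gt0// mulr_gt0// addr_gt0.
suff key e : 0 < e -> mdist (v T) (S T (v 0)) <= c * e.
  apply: mdist_positivity; apply/eqP; rewrite eq_le mdist_ge0 andbT.
  apply/ler_addgt0Pr => e e0; rewrite add0r.
  by have := key (e / c) (divr_gt0 e0 c0); rewrite mulrCA divff ?gt_eqF// mulr1.
move=> e0.
(* Bounds the energy lost up to [T + s] for small [s], since [p (v (T + s))] is then above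
   [p (v T) - 1]. *)
pose L := p (v 0) - p (v T) + 1.
have L1 : 1 <= L.
  by rewrite lerDr subr_ge0 (EDI_phi_le phi_proper phi_lsc v_AC v_EDI v_D S_flow)//
    ltW.
have e2 : 0 < e ^+ 2 by rewrite exprn_gt0.
have vD := EDI_Dom v_EDI.
have cv := AC2_loc_continuous v_AC.
have vc t : 0 <= t -> v (t + s) @[s --> (0 : R)^'+] --> v t.
  move=> t0; have : v (Num.max 0 (t + s)) @[s --> (0 : R)] --> v (Num.max 0 (t + 0)).
    by apply: (@continuous_comp _ _ _ (fun s : R => t + s) (fun t : R =>
      v (Num.max 0 t))); [apply: cvgD; [exact: cvg_cst|exact: cvg_id]|exact: cv].
  rewrite addr0 max_r// => /cvg_at_right_filter; apply: cvg_trans.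
  apply: near_eq_cvg; near=> s.
  have s0 : 0 <= s by near: s; exact: nbhs_right_ge.
  by rewrite max_r// addr_ge0.
have small t a : 0 <= t -> 0 < a -> \forall s \near (0 : R)^'+,
    p (v t) - a < p (v (t + s)) /\ mdist (v (t + s)) (v t) < e.
  move=> t0 a0.
  have pt : p (v t) - a < p (v t) by rewrite ltrBlDr ltrDl.
  have H1 := vc t t0 _ (fine_phi_lsc phi_proper phi_lsc (vD _ t0) pt).
  have /cvg_mdist/(_ _ e0) H2 := vc t t0.
  near=> s; split; last first.
    by near: s.
  have s0 : 0 <= s by near: s; exact: nbhs_right_ge.
  have ts0 : 0 <= t + s by rewrite addr_ge0.
  have : Dom phi (v (t + s)) -> p (v t) - a < p (v (t + s)); last by apply; exact: vD.
  by near: s.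
pose q h := mu * h * expR (mu * h).
have cE : continuous (fun h : R => expR (mu * h)).
  move=> h; apply: continuous_comp; last exact: continuous_expR.
  by apply: cvgM; [exact: cvg_cst|exact: cvg_id].
have qs : \forall h \near (0 : R)^'+, q h * (2 * L + e ^+ 2) < e ^+ 2.
  have : q h * (2 * L + e ^+ 2) @[h --> (0 : R)^'+] --> q 0 * (2 * L + e ^+ 2).
    apply: cvg_at_right_filter; apply: cvgM; last exact: cvg_cst.
    by apply: cvgM; [apply: cvgM; [exact: cvg_cst|exact: cvg_id]|exact: cE].
  by move/cvgr_lt; apply; rewrite /q mulr0 !mul0r.
have ks : \forall h \near (0 : R)^'+, 2 * (mu * h) * L < e ^+ 2.
  have : 2 * (mu * h) * L @[h --> (0 : R)^'+] --> 2 * (mu * 0) * L.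
    apply: cvg_at_right_filter; apply: cvgM; last exact: cvg_cst.
    apply: cvgM; first exact: cvg_cst.
    by apply: cvgM; [exact: cvg_cst|exact: cvg_id].
  by move/cvgr_lt; apply; rewrite mulr0 mulr0 mul0r.
(* Near time [0] the energy must be recovered up to [e ^+ 2]; at [T] an error of 1 suffices, as [L]
   only enters multiplied by vanishing factors. *)
have [r /= r0 rP] := filterI (filterI qs ks) (filterI (small 0 _ (lexx 0) e2) (small
  T 1 (ltW T0) ltr01)).
pose n := (Num.bound (T / r)).+1.
pose h := T / n%:R.
have n0 : 0 < n%:R :> R by rewrite ltr0n.
have h0 : 0 < h by rewrite divr_gt0.
have hr : h < r.
  rewrite ltr_pdivrMr// mulrC -ltr_pdivrMr// (lt_trans (archi_boundP _))//.
    by rewrite divr_ge0 ?ltW.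
  by rewrite ltr_nat.
have nT : n%:R * h = T by rewrite /h mulrC divfK// gt_eqF.
have rP' s : 0 < s -> s < r -> _ := fun s0 sr =>
  rP s ltac:(by rewrite /= sub0r normrN gtr0_norm) s0.
have [[qh kh] _] := rP' h h0 hr.
have [s [A [B [/andP[s0 sh] A0 B0 AB st]]]] :=
  EDI_partition phi_proper phi_lsc v_AC v_EDI v_D S_flow h0 e2 nT T0.
have [_ [[p0s d0s] [pTs dTs]]] := rP' s s0 (le_lt_trans sh hr).
rewrite !add0r in p0s d0s.
have := st e e0; clear st.
have pTs0 : p (v (T + s)) <= p (v 0).
  by apply: (EDI_phi_le phi_proper phi_lsc v_AC v_EDI v_D S_flow);
    rewrite addr_ge0 ?ltW.
have ps0 : p (v s) <= p (v 0).
  by apply: (EDI_phi_le phi_proper phi_lsc v_AC v_EDI v_D S_flow); exact: ltW.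
rewrite -/mu -/(q h) -/(p _) -/(p (v s)).
set k := _ / h.
have k1 : k <= 1 by rewrite ler_pdivrMr// mul1r expint_le.
have kmu : 1 - mu * h <= k.
  rewrite ler_pdivlMr//; apply: le_trans (@expint_ge _ lambda h).
  rewrite mulrC ler_wpM2l ?(ltW h0)//; exact: expR_ge1Dx.
have q0 : 0 <= q h by rewrite mulr_ge0 ?expR_ge0// mulr_ge0// ltW.
set d1 := mdist (S T _) _ => H.
(* The 5 counts two [e ^+ 2] for twice the gap between [p (v 0)] and [p (v s)], and one each for [k]
   differing from 1, for the excess of the Riemann sum and for the factor [q h]. *)
have num : A + 2 * k * (p (v (T + s)) - p (v s)) + (1 + q h) * (B + e ^+ 2) <= 5 * e
  ^+ 2.
  have AB' : A + B <= 2 * (p (v 0) - p (v (T + s))) by exact: AB.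
  have H1 : (1 - k) * (p (v s) - p (v (T + s))) <= (1 - k) * L.
    by rewrite ler_wpM2l ?subr_ge0// /L; lra.
  have H2 : (1 - k) * L <= mu * h * L by rewrite ler_wpM2r//; lra.
  have H3 : q h * (B + e ^+ 2) <= q h * (2 * L + e ^+ 2).
    by rewrite ler_wpM2l// lerD2r /L; lra.
  by lra.
have d1E : d1 <= E * ((5 + T) / 2 * e).
  have EE : E * expR (- (mu * T)) = 1 by rewrite -expRD addrN expR0.
  rewrite [leLHS](_ : d1 = E * (expR (- (mu * T)) * d1));
    last by rewrite mulrA EE mul1r.
  rewrite ler_pM2l// (le_trans H)//; set N := (X in X / e).
  have : N / e <= 5 * e by rewrite ler_pdivrMr//; move: num; rewrite -/N; lra.
  lra.
have TD : mdist (S T (v s)) (S T (v 0)) <= E * mdist (v s) (v 0).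
  by apply: (flow_contraction phi_proper phi_lsc S_flow);
    [exact: v_D (ltW s0)|exact: v_D|exact: vD (ltW s0)|exact: vD|exact: ltW].
have := metric_triangle (v T) (v (T + s)) (S T (v 0)).
have := metric_triangle (v (T + s)) (S T (v s)) (S T (v 0)).
rewrite (metric_sym (v T) (v (T + s))) (metric_sym (v (T + s)) (S T (v s))) -/d1.
have := ler_wpM2l (ltW E0) (ltW d0s).
move: TD dTs d1E; rewrite /c; lra.
Unshelve. all: by end_near. Qed.
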